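(* Let $G$ be a finitely generated residually finite group. For every sequence $\{N_i\}_{i\in\mathbb N}$ of finite index normal subgroups of $G$ satisfying $N_1\ge N_2\ge \cdots$ and $\bigcap_{i=1}^\infty N_i=\{1\}$, we have $$b_1^{(2)}(G)\ \ge\ \limsup_{i\to\infty}\frac{b_1(N_i)}{[G:N_i]}.$$
   Context: For a group $H$, $b_1(H)$ denotes the ordinary first betti number $\dim_{\mathbb Q} H_1(H;\mathbb Q)$. $b_1^{(2)}(G)$ denotes the first $L^2$-betti number of $G$, i.e. $b_1^{(2)}(G)=\dim_{\mathcal N(G)} H_1(EG;\mathcal N(G))$, where $\mathcal N(G)$ is the group von Neumann algebra of $G$, $EG$ is a contractible free $G$-CW-complex, $H_1(EG;\mathcal N(G))$ is the first homology of $\mathcal N(G)\otimes_{\mathbb Z G} C_*(EG)$, and $\dim_{\mathcal N(G)}$ is Lück's extended von Neumann dimension, defined for arbitrary $\mathcal N(G)$-modules. *)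

(* Defs.v *)
From HB Require Import structures.
From mathcomp Require Import all_boot all_order all_algebra.
From mathcomp Require Import complex generic_quotient ring_quotient finmap.
From mathcomp Require Import all_classical all_reals all_analysis.
From mathcomp Require Import lra.

Set Implicit Arguments.
Unset Strict Implicit.
Unset Printing Implicit Defensive.

Import Order.TTheory GRing.Theory Num.Theory.

Local Open Scope classical_set_scope.
Local Open Scope ring_scope.

Section Subgroups.
Variable G : groupType.
Implicit Type K : groupClosed G.

Definition lcosets K : set (set G) :=
  [set [set (g * x)%g | x in [set` K]] | g in [set: G]].

Definition finite_index K := finite_set (lcosets K).

Definition gindex K : nat := (#|` fset_set (lcosets K)|)%fset.

Definition normal_subgroup K := forall x g, x \in K -> (x ^ g)%g \in K.

Definition finitely_generated := exists s : seq G,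
  forall K, {subset s <= K} -> forall g, g \in K.

Definition residually_finite := forall g : G, g != 1%g ->
  exists K, [/\ normal_subgroup K, finite_index K & g \notin K].

End Subgroups.

Section SubgroupOf.
Variables (G : groupType) (K : groupClosed G).

Definition subgroup_of := {x : G | x \in K}.

HB.instance Definition _ := SubChoice.on subgroup_of.

Fact subgroup_of_closed : group_closed K.
Proof. by split; [exact: gpred1|exact: gpredF]. Qed.

HB.instance Definition _ :=
  SubChoice_isSubGroup.Build G _ subgroup_of subgroup_of_closed.

End SubgroupOf.

Section LSpan.
Variables (R : nzRingType) (V : lmodType R) (A : set V).

Definition is_submod (B : set V) :=
  B 0 /\ forall a u v, B u -> B v -> B (a *: u + v).

Definition lspan : set V := smallest is_submod A.

Lemma is_submod_lspan : is_submod lspan.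
Proof.
split=> [B [[]]//|a u v su sv B BA].
by case: (BA) => -[_ BZ] _; apply: BZ; [exact: su|exact: sv].
Qed.

Lemma sub_lspan : A `<=` lspan.
Proof. by move=> x Ax B [_]; exact. Qed.

Lemma lspan_min (B : set V) : is_submod B -> A `<=` B -> lspan `<=` B.
Proof. by move=> sB AB x; apply. Qed.

Definition lspan_mem : {pred V} := fun v => v \in lspan.

Fact lspan_mem_closed : submod_closed lspan_mem.
Proof.
have [h0 hZ] := is_submod_lspan.
split=> [|a u v]; rewrite -!topredE/= /lspan_mem ?inE//; exact: hZ.
Qed.

HB.instance Definition _ :=
  GRing.isSubmodClosed.Build R V lspan_mem lspan_mem_closed.

End LSpan.

(* lquot A is the quotient of V by the submodule generated by A. *)
Section LQuot.
Variables (R : nzRingType) (V : lmodType R) (A : set V).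
Local Open Scope quotient_scope.

Definition lquot := Quotient.quot (@lspan_mem R V A : zmodClosed V).

HB.instance Definition _ := GRing.Zmodule.on lquot.

Definition lquot_pi (v : V) : lquot := \pi_lquot v.
Definition lquot_repr (x : lquot) : V := repr x.

Lemma lquot_reprK : cancel lquot_repr lquot_pi.
Proof. exact: reprK. Qed.

Lemma lquot_piD u v : lquot_pi (u + v) = lquot_pi u + lquot_pi v.
Proof. by rewrite /lquot_pi; exact: Quotient.pi_add. Qed.

Lemma lquot_eqP u v : reflect (lspan A (u - v)) (lquot_pi u == lquot_pi v).
Proof.
rewrite /lquot_pi -Quotient.idealrBE; apply: (iffP idP).
  by rewrite -topredE/= /lspan_mem inE.
by rewrite -topredE/= /lspan_mem inE.
Qed.

Definition lquot_scale (a : R) (x : lquot) := lquot_pi (a *: lquot_repr x).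

Lemma lquot_scale_pi a v : lquot_scale a (lquot_pi v) = lquot_pi (a *: v).
Proof.
apply/eqP/lquot_eqP; rewrite -scalerBr -[_ *: _]addr0.
have [h0 hZ] := is_submod_lspan A.
by apply: hZ => //; apply/lquot_eqP; rewrite lquot_reprK.
Qed.

Fact lquot_scaleA a b x : lquot_scale a (lquot_scale b x) = lquot_scale (a * b) x.
Proof. by rewrite -[x]lquot_reprK !lquot_scale_pi scalerA. Qed.
Fact lquot_scale1 : left_id 1 lquot_scale.
Proof. by move=> x; rewrite -[x]lquot_reprK lquot_scale_pi scale1r. Qed.
Fact lquot_scaleDr : right_distributive lquot_scale +%R.
Proof.
move=> a x y; rewrite -[x]lquot_reprK -[y]lquot_reprK.
by rewrite -lquot_piD !lquot_scale_pi scalerDr lquot_piD.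
Qed.
Fact lquot_scaleDl x : {morph lquot_scale^~ x : a b / a + b}.
Proof.
by move=> a b; rewrite -[x]lquot_reprK !lquot_scale_pi scalerDl lquot_piD.
Qed.

HB.instance Definition _ := GRing.Zmodule_isLmodule.Build R lquot
  lquot_scaleA lquot_scale1 lquot_scaleDr lquot_scaleDl.

Fact lquot_pi_is_linear : linear lquot_pi.
Proof. by move=> a u v; rewrite lquot_piD -lquot_scale_pi. Qed.

HB.instance Definition _ :=
  GRing.isLinear.Build R V lquot *:%R lquot_pi lquot_pi_is_linear.

End LQuot.

Section LQuotMap.
Variables (R : nzRingType) (U V : lmodType R) (A : set U) (B : set V).
Variables (f : {linear U -> V}) (fAB : f @` A `<=` lspan B).

(* The unused proof argument guarantees that f does induce a map. *)
Definition lquot_map of f @` A `<=` lspan B : lquot A -> lquot B :=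
  fun x => lquot_pi B (f (lquot_repr x)).

Lemma lquot_map_pi u : lquot_map fAB (lquot_pi A u) = lquot_pi B (f u).
Proof.
apply/eqP/lquot_eqP; rewrite -linearB.
have : lspan A (lquot_repr (lquot_pi A u) - u).
  by apply/lquot_eqP; rewrite lquot_reprK.
have [h0 hZ] := is_submod_lspan B.
apply: (@lspan_min _ _ A (f @^-1` lspan B)) => [|x Ax]; last first.
  by apply: fAB; exists x.
by split=> [|a x y fx fy] /=; rewrite ?linear0// linearP; exact: hZ.
Qed.

Fact lquot_map_is_linear : linear (lquot_map fAB).
Proof.
move=> a x y; rewrite -[x]lquot_reprK -[y]lquot_reprK.
by rewrite -linearP !lquot_map_pi -linearP -linearP.
Qed.

HB.instance Definition _ := GRing.isLinear.Build R (lquot A) (lquot B) *:%R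
  (lquot_map fAB) lquot_map_is_linear.

End LQuotMap.

Section Homology.
Variables (R : nzRingType) (U V W : lmodType R).

Section Kernel.
Variable g : {linear V -> W}.

Definition lker_mem : {pred V} := fun v => g v == 0.

Fact lker_mem_closed : submod_closed lker_mem.
Proof.
split=> [|a u v]; rewrite -!topredE/= /lker_mem ?linear0// linearP.
by move=> /eqP-> /eqP->; rewrite scaler0 addr0.
Qed.

HB.instance Definition _ :=
  GRing.isSubmodClosed.Build R V lker_mem lker_mem_closed.

Definition lkernel := {v : V | v \in lker_mem}.

HB.instance Definition _ := SubChoice.on lkernel.
HB.instance Definition _ := [SubChoice_isSubLmodule of lkernel by <:].

End Kernel.

(* ker g / im f *)
Definition homology (f : {linear U -> V}) (g : {linear V -> W}) : lmodType R :=
  lquot [set z : lkernel g | range f (val z)].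

End Homology.

(* The free left R-module with basis S. *)
Section FinSupp.
Variables (R : nzRingType) (S : choiceType).

Definition finsupp_mem : {pred S -> R^o} :=
  fun c => `[< finite_set [set s | c s != 0] >].

Fact finsupp_mem_closed : submod_closed finsupp_mem.
Proof.
split=> [|a u v]; rewrite -!topredE/= /finsupp_mem.
  by apply/asboolP; rewrite (_ : mkset _ = set0)// -subset0 => s /=; rewrite eqxx.
move=> /asboolP fu /asboolP fv; apply/asboolP.
apply: (@sub_finite_set _ _ ([set s | u s != 0] `|` [set s | v s != 0])).
  move=> s /= h; have [us|] := eqVneq (u s) 0; last by left.
  right; apply: contra_neq h => vs.
  by rewrite !fctE us vs scaler0 addr0.
by rewrite finite_setU.
Qed.

HB.instance Definition _ :=
  GRing.isSubmodClosed.Build R (S -> R^o) finsupp_mem finsupp_mem_closed.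

Definition finsupp := {c : S -> R^o | c \in finsupp_mem}.

HB.instance Definition _ := SubChoice.on finsupp.
HB.instance Definition _ := [SubChoice_isSubLmodule of finsupp by <:].

Lemma finsuppP (c : finsupp) : finite_set [set s | val c s != 0].
Proof. by have /asboolP := valP c. Qed.

Fact single_mem (x : R) (s : S) :
  ((fun t => if t == s then x else 0) : S -> R^o) \in finsupp_mem.
Proof.
apply/asboolP/(sub_finite_set _ (finite_set1 s)) => t /=.
by case: ifPn => [/eqP//|_]; rewrite eqxx.
Qed.

Definition single x s : finsupp := 
  exist (fun c : S -> R^o => c \in finsupp_mem) _ (single_mem x s).

End FinSupp.

Section Push.
Variables (R : nzRingType) (S T : choiceType) (f : S -> T).

Definition push_fun (c : finsupp R S) : T -> R^o :=
  fun t => \sum_(s \in [set s | f s = t]) val c s.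

Lemma push_funE (r : seq S) (c : finsupp R S) t : uniq r ->
  (forall s, val c s != 0 -> s \in r) ->
  push_fun c t = \sum_(s <- r | f s == t) val c s.
Proof.
move=> ur cr; rewrite /push_fun fsbig_mkcond [RHS]big_mkcond/=.
rewrite (@fsbigE _ _ _ _ _ r)//=; last first.
  move=> s _ sr; rewrite /patch; case: ifP => // _.
  by apply: contraNeq sr; exact: cr.
rewrite big_mkcond; apply: eq_bigr => s _; rewrite in_setT /patch.
congr (if _ then _ else _); apply/idP/eqP; first by rewrite inE.
by move=> fs; rewrite inE.
Qed.

Fact push_mem c : push_fun c \in @finsupp_mem R T.
Proof.
apply/asboolP.
apply: (@sub_finite_set _ _ (f @` [set s | val c s != 0])); last first.
  exact/finite_image/finsuppP.
move=> t /= /eqP ht; apply: contrapT => nt; apply: ht.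
rewrite /push_fun fsbig1// => s /= fs; apply: contrapT => /eqP cs.
by apply: nt; exists s.
Qed.

Definition push c : finsupp R T := 
  exist (fun d : T -> R^o => d \in @finsupp_mem R T) _ (push_mem c).

Fact push_is_linear : linear push.
Proof.
move=> a u v; apply/val_inj/funext => t /=.
have := conj (finsuppP u) (finsuppP v); rewrite -finite_setU => fuv.
set r := finmap.enum_fset (fset_set ([set s | val u s != 0] `|`
  [set s | val v s != 0])).
have rP s : (s \in r) = `[< val u s != 0 \/ val v s != 0 >].
  by rewrite in_fset_set//; apply/idP/asboolP; rewrite inE.
have ur : uniq r by exact: finmap.fset_uniq.
have [hu hv] : (forall s, val u s != 0 -> s \in r) /\
    (forall s, val v s != 0 -> s \in r).
  by split=> s h; rewrite rP; apply/asboolP; [left|right].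
rewrite !fctE !(push_funE t ur)// => [|s].
  by rewrite scaler_sumr -big_split.
rewrite rP => h; apply/asboolP.
have [us|] := eqVneq (val u s) 0; last by left.
right; apply: contra_neq h => vs.
by rewrite [val _]/= !fctE us vs scaler0 addr0.
Qed.

HB.instance Definition _ := GRing.isLinear.Build R (finsupp R S) (finsupp R T)
  *:%R push push_is_linear.

End Push.

Lemma push_single (R : nzRingType) (S T : choiceType) (f : S -> T) x s :
  push f (single x s) = single x (f s) :> finsupp R T.
Proof.
apply/val_inj/funext => t /=; rewrite (@push_funE _ _ _ _ [:: s])//=.
  by rewrite big_mkcond big_seq1 eqxx eq_sym.
by move=> r; case: ifPn => [/eqP->|_]; rewrite ?eqxx// inE.
Qed.

(* The model of EG is the Delta-complex whose n-simplices are the (n+1)-tuples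
   of elements of G, with G acting diagonally by left multiplication: it is a
   contractible free G-CW-complex with C_n(EG) = Z[G^(n+1)]. For a ring R and
   u : G -> R multiplicative, R is an (R, ZG)-bimodule via x.g = x * u g, and
   R (x)_{ZG} C_n(EG) is the free left R-module on G^(n+1) modulo the relations
   x.g (x) s = x (x) g.s. *)
Section EquivariantHomology.
Variable G : groupType.

Definition simplex (n : nat) := {ffun 'I_n.+1 -> G}.

Definition face n (i : 'I_n.+2) (s : simplex n.+1) : simplex n :=
  [ffun j => s (lift i j)].

Definition sact n (g : G) (s : simplex n) : simplex n := [ffun j => (g * s j)%g].

Lemma face_sact n i g (s : simplex n.+1) : face i (sact g s) = sact g (face i s).
Proof. by apply/ffunP => j; rewrite !ffunE. Qed.

Variables (R : nzRingType) (u : G -> R).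

Definition boundary n (c : finsupp R (simplex n.+1)) : finsupp R (simplex n) :=
  \sum_(i < n.+2) (-1) ^+ i *: push (face i) c.

Fact boundary_is_linear n : linear (@boundary n).
Proof.
move=> a c d; rewrite /boundary scaler_sumr -big_split; apply: eq_bigr => i _.
by rewrite linearP scalerDr !scalerA commr_sign.
Qed.

HB.instance Definition _ n := GRing.isLinear.Build R (finsupp R (simplex n.+1))
  (finsupp R (simplex n)) *:%R (@boundary n) (@boundary_is_linear n).

Definition tensor_rel n : set (finsupp R (simplex n)) :=
  [set c | exists x g s, c = single (x * u g) s - single x (sact g s)].

Definition tensor_chain n : lmodType R := lquot (@tensor_rel n).

Fact boundary_tensor_rel n :
  @boundary n @` @tensor_rel n.+1 `<=` lspan (@tensor_rel n).
Proof.
move=> _ [_ [x [g [s ->]]] <-]; rewrite linearB /boundary -sumrB.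
have [h0 hZ] := is_submod_lspan (@tensor_rel n).
apply: (big_ind (lspan (@tensor_rel n))) => //.
  by move=> c d hc hd; rewrite -[c]scale1r; exact: hZ.
move=> i _; rewrite -scalerBr -[_ *: _]addr0; apply: hZ => //.
apply: sub_lspan; exists x, g, (face i s).
by rewrite !push_single face_sact.
Qed.

Definition tensor_boundary n : {linear tensor_chain n.+1 -> tensor_chain n} :=
  lquot_map (@boundary_tensor_rel n).

Definition H1 : lmodType R := homology (tensor_boundary 1) (tensor_boundary 0).

End EquivariantHomology.

Definition rat_dim (R : realType) (V : lmodType rat) : \bar R :=
  ereal_sup [set (n%:R)%:E |
    n in [set n : nat | exists f : {linear 'rV[rat]_n -> V}, injective f]].

Definition b1 (R : realType) (G : groupType) : \bar R :=
  rat_dim R (H1 (fun _ : G => 1 : rat)).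

Lemma normc_ge0 (R : realType) (z : R[i]) : 0 <= Normc.normc z.
Proof. by case: z => a b /=; exact: sqrtr_ge0. Qed.

Section EllTwo.
Variables (R : realType) (G : groupType).
Local Notation C := (R[i]).

Definition sqnorm (x : G -> C^o) : \bar R :=
  \esum_(g in [set: G]) ((Normc.normc (x g)) ^+ 2)%:E.

Lemma sqnorm_ge0 x : (0 <= sqnorm x)%E.
Proof. by apply: esum_ge0 => g _; rewrite lee_fin sqr_ge0. Qed.

Lemma sqnormD x y :
  (sqnorm (x + y)%R <= (sqnorm x + sqnorm x) + (sqnorm y + sqnorm y))%E.
Proof.
have h0 (z : G -> C^o) i : (0 <= ((Normc.normc (z i)) ^+ 2)%:E)%E.
  by rewrite lee_fin sqr_ge0.
rewrite /sqnorm -!esumD; try by move=> *; rewrite ?adde_ge0.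
apply: le_esum => g _; rewrite -!EFinD lee_fin.
suff key (a b c : R) : 0 <= c -> c <= a + b ->
    c ^+ 2 <= a ^+ 2 + a ^+ 2 + (b ^+ 2 + b ^+ 2).
  by apply: key; [exact: normc_ge0|exact: (@le_normcD R (x g) (y g))].
move=> c0 cab; have := sqr_ge0 (a - b).
have : c ^+ 2 <= (a + b) ^+ 2 by rewrite ler_pXn2r// nnegrE (le_trans c0).
by rewrite sqrrB sqrrD; lra.
Qed.

Lemma sqnormZ (a : C) x :
  (sqnorm (a *: x)%R <= (Normc.normc a ^+ 2)%:E * sqnorm x)%E.
Proof.
apply: ub_ereal_sup => _ [A fA <-].
rewrite (eq_fsbigr (fun g => (Normc.normc a ^+ 2)%:E *
   ((Normc.normc (x g)) ^+ 2)%:E)%E); last first.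
  by move=> g _; rewrite fctE Normc.normcM exprMn EFinM.
rewrite -ge0_mule_fsumr; last by move=> g; rewrite lee_fin sqr_ge0.
by rewrite lee_wpmul2l ?lee_fin ?sqr_ge0//; apply: ereal_sup_ubound; exists A.
Qed.

Lemma sqnorm_bij (f : G -> G) x : bijective f -> sqnorm (x \o f) = sqnorm x.
Proof.
move=> fbij; have ff : set_bij [set: G] [set: G] f by rewrite setTT_bijective.
by rewrite /sqnorm [RHS](reindex_esum _ _ _ _ ff).
Qed.

Definition ell2_mem : {pred G -> C^o} := fun x => `[< (sqnorm x < +oo)%E >].

Fact ell2_mem_closed : submod_closed ell2_mem.
Proof.
split=> [|a x y]; rewrite -!topredE/= /ell2_mem.
  apply/asboolP; rewrite /sqnorm esum1 ?ltry// => g _.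
  by rewrite Normc.normc0 expr0n.
move=> /asboolP hx /asboolP hy; apply/asboolP.
have hax : (sqnorm (a *: x)%R < +oo)%E.
  apply: (le_lt_trans (sqnormZ a x)).
  have := sqnorm_ge0 x; case: (sqnorm x) hx => // r _ _.
  by rewrite -EFinM ltry.
by apply: (le_lt_trans (sqnormD _ _)); rewrite !lte_add_pinfty.
Qed.

HB.instance Definition _ :=
  GRing.isSubmodClosed.Build C (G -> C^o) ell2_mem ell2_mem_closed.

Definition ell2 := {x : G -> C^o | x \in ell2_mem}.

HB.instance Definition _ := SubChoice.on ell2.
HB.instance Definition _ := [SubChoice_isSubLmodule of ell2 by <:].

Lemma ell2P (x : ell2) : (sqnorm (val x) < +oo)%E.
Proof. by have /asboolP := valP x. Qed.

Definition ell2_norm (x : ell2) : R := Num.sqrt (fine (sqnorm (val x))).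

Lemma ell2_normD x y : ell2_norm (x + y) <= 2 * (ell2_norm x + ell2_norm y).
Proof.
have hx : sqnorm (val x) \is a fin_num.
  by rewrite ge0_fin_numE ?sqnorm_ge0//; exact: ell2P.
have hy : sqnorm (val y) \is a fin_num.
  by rewrite ge0_fin_numE ?sqnorm_ge0//; exact: ell2P.
have hxy : sqnorm (val (x + y)) \is a fin_num.
  by rewrite ge0_fin_numE ?sqnorm_ge0//; exact: ell2P.
have nn0 z : 0 <= ell2_norm z by exact: sqrtr_ge0.
rewrite -(@ler_pXn2r _ 2)// ?nnegrE ?mulr_ge0 ?addr_ge0//.
have sq z : ell2_norm z ^+ 2 = fine (sqnorm (val z)).
  by rewrite sqr_sqrtr// fine_ge0// sqnorm_ge0.
have := sqnormD (val x) (val y).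
rewrite -(fineK hxy) -(fineK hx) -(fineK hy) -!EFinD lee_fin -!sq.
by have := mulr_ge0 (nn0 x) (nn0 y); nra.
Qed.

Lemma ell2_normN x : ell2_norm (- x) = ell2_norm x.
Proof.
rewrite /ell2_norm; congr (Num.sqrt (fine _)); apply: eq_esum => g _.
by rewrite -(@normcN R (val x g)).
Qed.

Fact ell2_comp_mem (f : G -> G) (x : ell2) :
  bijective f -> (val x \o f : G -> C^o) \in ell2_mem.
Proof.
by move=> fbij; apply/asboolP; rewrite sqnorm_bij//; exact: ell2P.
Qed.

Fact mulg_bij (g : G) : bijective (fun h => g * h)%g.
Proof. by exists (fun h => g^-1 * h)%g => h; rewrite ?mulKg ?mulVKg. Qed.

Fact mulrg_bij (g : G) : bijective (fun h => h * g)%g.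
Proof. by exists (fun h => h * g^-1)%g => h; rewrite ?mulgK ?mulgVK. Qed.

Let ell2_Sub (x : G -> C^o) (hx : x \in ell2_mem) : ell2 :=
  exist (fun x : G -> C^o => x \in ell2_mem) x hx.

(* Left translation by g, sending the basis vector h to g h. *)
Definition ltrans (g : G) (x : ell2) : ell2 :=
  ell2_Sub (ell2_comp_mem x (mulg_bij g^-1)).

(* Right translation by g^-1, sending the basis vector h to h g^-1. *)
Definition rtrans (g : G) (x : ell2) : ell2 :=
  ell2_Sub (ell2_comp_mem x (mulrg_bij g)).

Fact ell2_delta_mem (g : G) : ((fun h => (h == g)%:R) : G -> C^o) \in ell2_mem.
Proof.
apply/asboolP; rewrite /sqnorm (esumID [set g]) => [|h _]; last first.
  by rewrite lee_fin sqr_ge0.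
rewrite !setTI esum_set1 ?lee_fin ?sqr_ge0//.
rewrite [X in (_ + X)%E]esum1 ?adde0 ?ltry// => h /= /eqP/negPf ->.
by rewrite Normc.normc0 expr0n.
Qed.

Definition ell2_delta (g : G) : ell2 := ell2_Sub (ell2_delta_mem g).

End EllTwo.

(* The group von Neumann algebra: bounded operators on ell^2(G) commuting with
   the left regular representation. *)
Section GroupVonNeumannAlgebra.
Variables (R : realType) (G : groupType).
Local Notation ell2 := (ell2 R G).

Definition bounded_op (T : ell2 -> ell2) :=
  exists M : R, forall x, ell2_norm (T x) <= M * ell2_norm x.

Definition gvN_mem : {pred ell2 -> ell2} := fun T =>
  `[< [/\ linear T, bounded_op T & forall g x, T (ltrans g x) = ltrans g (T x)] >].

Lemma ltransB g (x y : ell2) : ltrans g (x - y) = ltrans g x - ltrans g y.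
Proof. exact/val_inj. Qed.

Lemma ltrans0 g : ltrans g (0 : ell2) = 0.
Proof. exact/val_inj. Qed.

Fact gvN_mem_closed : zmod_closed gvN_mem.
Proof.
split=> [|S T]; rewrite -!topredE/= /gvN_mem.
  apply/asboolP; split=> [a x y|| g x].
  - by rewrite -[LHS]/0 -[RHS]/(a *: 0 + 0) scaler0 addr0.
  - exists 0 => x; rewrite mul0r -[X in ell2_norm X]/(0 : ell2).
    rewrite /ell2_norm /sqnorm esum1 ?sqrtr0// => g _.
    by rewrite Normc.normc0 expr0n.
  - by rewrite -[RHS]/(ltrans g 0) ltrans0.
move=> /asboolP[Sl [m Sm] Sc] /asboolP[Tl [n Tn] Tc]; apply/asboolP.
have STE x : (S - T) x = S x - T x by [].
split=> [a x y||g x]; rewrite ?STE.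
- by rewrite Sl Tl scalerBr opprD addrACA.
- exists (2 * (m + n)) => x; rewrite STE.
  apply: (le_trans (ell2_normD _ _)); rewrite ell2_normN.
  by rewrite -mulrA ler_pM2l// mulrDl lerD.
- by rewrite Sc Tc ltransB.
Qed.

HB.instance Definition _ :=
  GRing.isZmodClosed.Build (ell2 -> ell2) gvN_mem gvN_mem_closed.

Definition gvN := {T : ell2 -> ell2 | T \in gvN_mem}.

HB.instance Definition _ := SubChoice.on gvN.
HB.instance Definition _ := [SubChoice_isSubZmodule of gvN by <:].

Lemma gvNP (T : gvN) : [/\ linear (val T), bounded_op (val T) &
  forall g x, val T (ltrans g x) = ltrans g (val T x)].
Proof. by have /asboolP := valP T. Qed.

Let gvN_Sub (T : ell2 -> ell2) (hT : T \in gvN_mem) : gvN :=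
  exist (fun T : ell2 -> ell2 => T \in gvN_mem) T hT.

Fact gvN_id_mem : id \in gvN_mem.
Proof.
by apply/asboolP; split=> //; exists 1 => x; rewrite mul1r.
Qed.

Fact gvN_comp_mem (S T : gvN) : (val S \o val T) \in gvN_mem.
Proof.
have [Sl [m Sm] Sc] := gvNP S; have [Tl [n Tn] Tc] := gvNP T.
apply/asboolP; split=> [a x y||g x] /=; [by rewrite Tl Sl| |by rewrite Tc Sc].
exists (`|m| * n) => x /=; apply: (le_trans (Sm _)).
apply: (@le_trans _ _ (`|m| * ell2_norm (val T x))).
  by rewrite ler_wpM2r ?sqrtr_ge0// ler_norm.
by rewrite -mulrA ler_wpM2l.
Qed.

Definition gvN_one := gvN_Sub gvN_id_mem.
Definition gvN_mul (S T : gvN) := gvN_Sub (gvN_comp_mem S T).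

Fact gvN_mulA : associative gvN_mul.
Proof. by move=> S T U; exact/val_inj. Qed.
Fact gvN_mul1 : left_id gvN_one gvN_mul.
Proof. by move=> S; exact/val_inj. Qed.
Fact gvN_mulr1 : right_id gvN_one gvN_mul.
Proof. by move=> S; exact/val_inj. Qed.
Fact gvN_mulDl : left_distributive gvN_mul +%R.
Proof. by move=> S T U; exact/val_inj. Qed.
Fact gvN_mulDr : right_distributive gvN_mul +%R.
Proof.
move=> S T U; apply/val_inj/funext => x /=; have [Sl _ _] := gvNP S.
by rewrite !fctE -[val T x]scale1r Sl !scale1r.
Qed.
Fact gvN_one_neq0 : gvN_one != 0.
Proof.
apply/eqP => /(congr1 (fun T => val (val T (ell2_delta R (1 : G)%g)) (1 : G)%g)) /=.
by rewrite eqxx => /eqP; rewrite oner_eq0.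
Qed.

HB.instance Definition _ := GRing.Zmodule_isNzRing.Build gvN
  gvN_mulA gvN_mul1 gvN_mulr1 gvN_mulDl gvN_mulDr gvN_one_neq0.

Fact rtrans_mem (g : G) : (@rtrans R G g) \in gvN_mem.
Proof.
apply/asboolP; split=> [a x y||h x].
- exact/val_inj.
- exists 1 => x; rewrite mul1r /ell2_norm sqnorm_bij//; exact: mulrg_bij.
- by apply/val_inj/funext => k /=; rewrite mulgA.
Qed.

(* The embedding of ZG into gvN is the right regular representation. *)
Definition gvN_of (g : G) : gvN := gvN_Sub (rtrans_mem g).

Lemma gvN_of1 : gvN_of 1%g = 1.
Proof. by apply/val_inj/funext => x; apply/val_inj/funext => k /=; rewrite mulg1. Qed.

Lemma gvN_ofM g h : gvN_of (g * h)%g = gvN_of g * gvN_of h.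
Proof.
by apply/val_inj/funext => x; apply/val_inj/funext => k /=; rewrite mulgA.
Qed.

(* <T e, e> for e the basis vector at the unit of G. *)
Definition gvN_trace (T : gvN) : R[i] :=
  val (val T (ell2_delta R (1 : G)%g)) (1 : G)%g.

Definition idempotent_mx n (A : 'M[gvN]_n) := A *m A = A.

(* P is isomorphic to the image of v |-> v A, by the restriction of a linear
   map f : any linear map on the image of an idempotent A extends to the whole
   module by precomposing with A. *)
Definition iso_to_image (M : lmodType gvN) (P : set M) n (A : 'M[gvN]_n) :=
  exists f : {linear 'rV[gvN]_n -> M},
    [/\ {in range (mulmx^~ A) &, injective f} & f @` range (mulmx^~ A) = P].

(* Lueck's dimension of an arbitrary module is the supremum of the dimensions
   of its finitely generated projective submodules P, where dim P is the trace
   of any idempotent matrix whose image is isomorphic to P. This trace is a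
   real number, so taking its real part loses nothing. *)
Definition luck_dim (M : lmodType gvN) : \bar R :=
  ereal_sup [set d | exists (P : set M) n (A : 'M[gvN]_n),
    [/\ idempotent_mx A, iso_to_image P A &
      d = (complex.Re (\sum_i gvN_trace (A i i)))%:E]].

End GroupVonNeumannAlgebra.

Definition b1_l2 (R : realType) (G : groupType) : \bar R :=
  luck_dim (H1 (@gvN_of R G)).

(* Main.v *)
(* Let G be generated by gen_1, ..., gen_d. Call a function on the edges of its
   Cayley graph harmonic if it is a gradient and is divergence free.
   The finite chains killed by all harmonic functions form a subspace B of the
   real Hilbert space l2 of edges; let P be the projection onto its orthogonal
   complement, and p the matrix of (the complexification of) P over the group von
   Neumann algebra. The image of p embeds in H_1(EG; N(G)), so that b_1^(2)(G) is at
   least tr p = sum_j <P e_j, e_j>, where e_j is the edge (1, gen_j).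

   Conversely, if N has finite index m, then b_1(N) is at most the dimension of the
   space of harmonic functions on the edges of G/N. Pick c_j in B with
   |e_j - c_j|^2 <= <P e_j, e_j> + eps. The images of the translates of the c_j in
   the edges of G/N are orthogonal to all harmonic functions, hence
   b_1(N) <= m * sum_j |image of e_j - c_j|^2, and once G -> G/N is injective on the
   finitely many vertices involved the image of e_j - c_j has the same norm as
   e_j - c_j. *)
Require Import Defs.
From HB Require Import structures.
From mathcomp Require Import all_boot all_order all_algebra.
From mathcomp Require Import complex.
From mathcomp Require Import all_classical all_reals all_analysis.
From mathcomp Require Import ring lra zify.

Set Implicit Arguments.
Unset Strict Implicit.
Unset Printing Implicit Defensive.

Import Order.TTheory GRing.Theory Num.Theory.
Import numFieldNormedType.Exports.

Local Open Scope classical_set_scope.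
Local Open Scope ring_scope.

(** * Orthogonal projections in Hilbert spaces *)

(** The group is only finitely generated, so the cycles of its Cayley graph may need infinitely many
    generating relations and the second boundary need not be a finite matrix over ZG. Cycles are
    therefore handled only through their pairing with harmonic functions, and each precision eps
    involves only finitely many finite chains. Such a lift has to be a gradient on G, not on G/N:
    its potential may change under N by a homomorphism from N to Q, and this is how H_1(N;Q) enters.
    The image of p embeds because an l2 harmonic form is a gradient, and differences of its
    potential give a 1-cocycle of G with values in l2. Pairing with this cocycle is defined on H_1,
    so a row v p with vanishing class sends every P u to 0, and p being idempotent gives v p = 0. *)

Section OrthogonalProjection.
Variables (R : realType) (V : lmodType R) (ip : V -> V -> R).
Hypothesis ipC : forall x y, ip x y = ip y x.
Hypothesis ipP : forall a x y z, ip (a *: x + y) z = a * ip x z + ip y z.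
Hypothesis ip_ge0 : forall x, 0 <= ip x x.
Hypothesis ip_eq0 : forall x, ip x x = 0 -> x = 0.
Hypothesis ip_complete : forall u : nat -> V,
  (forall e : R, 0 < e -> exists N, forall m n, (N <= m)%N -> (N <= n)%N ->
     ip (u m - u n) (u m - u n) <= e) ->
  exists l, forall e : R, 0 < e -> exists N, forall n, (N <= n)%N ->
     ip (u n - l) (u n - l) <= e.

Lemma ip0l z : ip 0 z = 0.
Proof. by have := ipP 1 0 0 z; rewrite scaler0 addr0 mul1r; lra. Qed.

Lemma ipDl x y z : ip (x + y) z = ip x z + ip y z.
Proof. by rewrite -[x in LHS]scale1r ipP mul1r. Qed.

Lemma ipZl a x z : ip (a *: x) z = a * ip x z.
Proof. by rewrite -[a *: x]addr0 ipP ip0l addr0. Qed.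

Lemma ipNl x z : ip (- x) z = - ip x z.
Proof. by rewrite -scaleN1r ipZl mulN1r. Qed.

Lemma ipDr x y z : ip z (x + y) = ip z x + ip z y.
Proof. by rewrite ipC ipDl ![ip _ z]ipC. Qed.

Lemma ipNr x z : ip z (- x) = - ip z x.
Proof. by rewrite ipC ipNl ipC. Qed.

Lemma ipZr a x z : ip z (a *: x) = a * ip z x.
Proof. by rewrite ipC ipZl ipC. Qed.

Lemma discriminant_le (a b c : R) : 0 <= c ->
  (forall t, 0 <= a - 2 * t * b + t ^+ 2 * c) -> b ^+ 2 <= a * c.
Proof.
move=> c0 h; have [c00|cn0] := eqVneq c 0.
  have [->|bn0] := eqVneq b 0; first by rewrite c00 expr0n mulr0.
  (* For [c = 0] the expression is affine in [t]; this [t] makes it equal to -1. *)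
  have := h ((a + 1) / (2 * b)); rewrite c00 mulr0 addr0.
  rewrite (_ : 2 * _ * b = a + 1); first by lra.
  by field.
have cp : 0 < c by rewrite lt0r cn0.
have := h (b / c); rewrite -(@ler_pM2r _ c)// mul0r => hh.
suff : (a - 2 * (b / c) * b + (b / c) ^+ 2 * c) * c = a * c - b ^+ 2 by lra.
by field.
Qed.

Lemma cauchy_schwarz x y : ip x y ^+ 2 <= ip x x * ip y y.
Proof.
apply: discriminant_le => // t; have := ip_ge0 (x - t *: y).
by rewrite !(ipDl, ipDr, ipNl, ipNr, ipZl, ipZr) (ipC y x); lra.
Qed.

Variable B : set V.
Hypothesis B_submod : is_submod B.

Lemma submodD x y : B x -> B y -> B (x + y).
Proof. by case: B_submod => _ h bx bY; rewrite -[x]scale1r; exact: h. Qed.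

Lemma submodZ a x : B x -> B (a *: x).
Proof. by case: B_submod => h0 h bx; rewrite -[_ *: _]addr0; exact: h. Qed.

Definition orthogonal_to x := forall b, B b -> ip x b = 0.

Definition in_closure x :=
  forall e : R, 0 < e -> exists2 b, B b & ip (x - b) (x - b) <= e.

(** Replacing [y] by [y - b] with [b] in [B] does not change the product, and Cauchy-Schwarz then
    makes it arbitrarily small. *)
Lemma orthogonal_closure x y : orthogonal_to x -> in_closure y -> ip x y = 0.
Proof.
move=> ox cy; apply/eqP; rewrite -sqrf_eq0 eq_le sqr_ge0 andbT.
apply/ler_addgt0Pr => e e0; rewrite add0r.
have e1 : 0 < e / (ip x x + 1) by rewrite divr_gt0// ltr_wpDl.
have [b Bb hb] := cy _ e1.
have -> : ip x y = ip x (y - b) by rewrite ipDr ipNr (ox _ Bb) subr0.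
apply: (le_trans (cauchy_schwarz _ _)).
apply: (@le_trans _ _ (ip x x * (e / (ip x x + 1)))); first exact: ler_wpM2l.
rewrite mulrCA -[leRHS]mulr1 ler_pM2l// ler_pdivrMr ?ltr_wpDl// mul1r.
by rewrite lerDl.
Qed.

(** A minimising sequence for the distance from [x] to [B] converges to some [l], and [y = x - l].
    Since [B] is not closed, [l] lies only in its closure. *)
Lemma projection_exists x : exists y, orthogonal_to y /\ in_closure (x - y).
Proof.
pose dist := [set r | exists2 b, B b & r = ip (x - b) (x - b)].
have dlb : has_inf dist.
  split; first by exists (ip (x - 0) (x - 0)), 0 => //; case: B_submod.
  by exists 0 => _ [b _ ->].
pose dl := inf dist.
have dlP b : B b -> dl <= ip (x - b) (x - b).
  by move=> Bb; apply: ge_inf; [case: dlb|exists b].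
have inv_gt0 n : 0 < (n.+1%:R : R)^-1 by rewrite invr_gt0.
have approx n : exists b, B b /\ ip (x - b) (x - b) <= dl + n.+1%:R^-1.
  have [_ [b Bb ->] h] := inf_adherent (inv_gt0 n) dlb.
  by exists b; split=> //; exact: ltW.
pose u n := projT1 (cid (approx n)).
have uB n : B (u n) by rewrite /u; case: cid => b [].
have uP n : ip (x - u n) (x - u n) <= dl + n.+1%:R^-1.
  by rewrite /u; case: cid => b [].
have harch (e : R) : 0 < e -> exists N, forall n, (N <= n)%N -> n.+1%:R^-1 <= e :> R.
  move=> e0; have [N _ hN] := near_infty_natSinv_lt (PosNum e0).
  by exists N => n /hN /ltW.
have [e e0|l hl] := @ip_complete u.
  have [N hN] := harch (e / 4) ltac:(lra).
  (* The midpoint of [u m] and [u n] lies in [B], so its distance to [x] is at least the infimum;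
     the parallelogram law then bounds the distance of [u m] and [u n]. *)
  exists N => m n Nm Nn; have := dlP _ (submodZ 2^-1 (submodD (uB m) (uB n))).
  move: (uP m) (uP n) (hN _ Nm) (hN _ Nn).
  rewrite !(ipDl, ipDr, ipNl, ipNr, ipZl, ipZr).
  rewrite (ipC (u m) x) (ipC (u n) x) (ipC (u n) (u m)).
  by move: (m.+1%:R^-1) (n.+1%:R^-1) => a b; lra.
have ort : orthogonal_to (x - l).
  move=> b Bb; apply/eqP; rewrite -sqrf_eq0 eq_le sqr_ge0 andbT.
  apply/ler_addgt0Pr => e e0; rewrite add0r.
  have [c c0 cE] : exists2 c : R, 0 <= c & ip b b = c by exists (ip b b).
  have e4 : 0 < e / (4 * (c + 1)) by apply: divr_gt0 => //; lra.
  have [N1 hN1] := harch _ e4.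
  have [N2 hN2] := hl _ e4.
  pose n := maxn N1 N2.
  have h1 := hN1 n (leq_maxl _ _); have h2 := hN2 n (leq_maxr _ _).
  (* Moving from [u n] by [t *: b] stays in [B] and so lowers the squared distance to [x] by at most
     [n.+1%:R^-1]; this holds for all [t], hence a discriminant bound. *)
  have h3 : ip (x - u n) b ^+ 2 <= n.+1%:R^-1 * c.
    apply: discriminant_le => // t; have := dlP _ (submodD (uB n) (submodZ t Bb)).
    have := uP n; rewrite !(ipDl, ipDr, ipNl, ipNr, ipZl, ipZr) cE.
    rewrite (ipC (u n) x) (ipC b x) (ipC b (u n)).
    by move: (n.+1%:R^-1) => a; lra.
  have h4 := cauchy_schwarz (u n - l) b.
  have h5 : e / (4 * (c + 1)) * c <= e / 4.
    rewrite invfM mulrA -mulrA -[leRHS]mulr1 ler_pM2l; last by lra.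
    by rewrite mulrC ler_pdivrMr ?mul1r; lra.
  have h6 : n.+1%:R^-1 * c <= e / 4 by apply: le_trans h5; exact: ler_wpM2r.
  have h7 : ip (u n - l) (u n - l) * ip b b <= e / 4.
    rewrite cE.
    by apply: le_trans h5; exact: ler_wpM2r.
  have -> : ip (x - l) b = ip (x - u n) b + ip (u n - l) b.
    by rewrite -ipDl addrA subrK.
  move: (le_trans h3 h6) (le_trans h4 h7).
  move: (ip _ b) (ip _ b) => p q hp hq {h1 h2 h3 h4 h5 h6 h7}.
  by have := sqr_ge0 (p - q); rewrite sqrrB sqrrD; lra.
exists (x - l); split=> // e e0; have [N hN] := hl _ e0.
exists (u N) => //; rewrite subKr -opprB ipNl ipNr opprK.
exact: hN.
Qed.

Definition ortho_proj x := projT1 (cid (projection_exists x)).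

Lemma ortho_proj_orthogonal x : orthogonal_to (ortho_proj x).
Proof. by rewrite /ortho_proj; case: cid => y []. Qed.

Lemma ortho_proj_closure x : in_closure (x - ortho_proj x).
Proof. by rewrite /ortho_proj; case: cid => y []. Qed.

Lemma in_closureP (a : R) x y : in_closure x -> in_closure y -> in_closure (a *: x + y).
Proof.
move=> cx cy e e0; have a1 : 0 < 4 * (a ^+ 2 + 1) by have := sqr_ge0 a; lra.
have [b Bb hb] := cx (e / (4 * (a ^+ 2 + 1))) ltac:(by rewrite divr_gt0).
have [c Bc hc] := cy (e / 4) ltac:(lra).
exists (a *: b + c); first exact: submodD (submodZ _ _) _.
have -> : a *: x + y - (a *: b + c) = a *: (x - b) + (y - c).
  by rewrite scalerBr opprD addrACA.
move: (x - b) (y - c) hb hc => v w hv hw.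
(* This yields |a v + w|^2 <= 2 a^2 |v|^2 + 2 |w|^2, and the two tolerances make each summand at
   most e/2. *)
have := ip_ge0 (a *: v - w).
have : a ^+ 2 * ip v v <= e / 4.
  apply: (@le_trans _ _ (a ^+ 2 * (e / (4 * (a ^+ 2 + 1))))).
    by rewrite ler_wpM2l// sqr_ge0.
  by rewrite mulrCA ler_pM2l// ler_pdivrMr//; have := sqr_ge0 a; lra.
by rewrite !(ipDl, ipDr, ipNl, ipNr, ipZl, ipZr) (ipC w v); lra.
Qed.

(** Two candidates differ by a vector that is both orthogonal to [B] and in its closure, hence
    orthogonal to itself. Linearity and equivariance of the projection follow from this
    characterisation. *)
Lemma ortho_proj_unique x y :
  orthogonal_to y -> in_closure (x - y) -> ortho_proj x = y.
Proof.
move=> oy cy; apply/eqP; rewrite -subr_eq0; apply/eqP/ip_eq0.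
have o : orthogonal_to (ortho_proj x - y).
  by move=> b Bb; rewrite ipDl ipNl oy// ortho_proj_orthogonal// subrr.
apply: orthogonal_closure => //.
have -> : ortho_proj x - y = (-1) *: (x - ortho_proj x) + (x - y).
  by rewrite scaleN1r opprB addrA subrK.
exact: in_closureP (@ortho_proj_closure _) _.
Qed.

Lemma ortho_proj_is_linear : linear ortho_proj.
Proof.
move=> a x y; apply: ortho_proj_unique => [b Bb|].
  by rewrite ipDl ipZl !ortho_proj_orthogonal// mulr0 addr0.
have -> : a *: x + y - (a *: ortho_proj x + ortho_proj y) =
    a *: (x - ortho_proj x) + (y - ortho_proj y).
  by rewrite scalerBr opprD addrACA.
by apply: in_closureP; exact: ortho_proj_closure.
Qed.

Lemma ortho_proj_id x : orthogonal_to x -> ortho_proj x = x.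
Proof.
move=> ox; apply: ortho_proj_unique => // e e0; exists 0; first by case: B_submod.
by rewrite !subrr ip0l ltW.
Qed.

Lemma ortho_proj0 x : B x -> ortho_proj x = 0.
Proof.
move=> Bx; apply: ortho_proj_unique => [b _|e e0]; first by rewrite ip0l.
by exists x => //; rewrite subr0 subrr ip0l ltW.
Qed.

Lemma ip_ortho_proj x : ip (ortho_proj x) (ortho_proj x) = ip (ortho_proj x) x.
Proof.
apply/eqP; rewrite -subr_eq0 -ipNr -ipDr -opprB ipNr.
by rewrite (orthogonal_closure (@ortho_proj_orthogonal x) (@ortho_proj_closure x)) oppr0.
Qed.

Lemma ortho_proj_le x : ip (ortho_proj x) (ortho_proj x) <= ip x x.
Proof.
have := ip_ge0 (x - ortho_proj x).
rewrite !(ipDl, ipNl, ipDr, ipNr) (ipC x) !ip_ortho_proj.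
by lra.
Qed.

(** Pythagoras: the projection of [x] is orthogonal to [b], so |x - b|^2 is its squared norm plus
    the squared distance from [b] to the complementary part of [x]. *)
Lemma ortho_proj_approx x (e : R) : 0 < e -> exists2 b, B b &
  ip (x - b) (x - b) <= ip (ortho_proj x) x + e.
Proof.
move=> e0; have [b Bb hb] := ortho_proj_closure x e0.
exists b => //; have o := @ortho_proj_orthogonal x _ Bb.
move: hb; rewrite !(ipDl, ipDr, ipNl, ipNr) (ipC b (ortho_proj x)) o (ipC b x).
by rewrite (ipC x (ortho_proj x)) ip_ortho_proj; lra.
Qed.

End OrthogonalProjection.

(** * The real Hilbert space of square-summable functions *)

Section RealEllTwo.
Variables (R : realType) (X : choiceType).

Definition esumsq (x : X -> R) : \bar R := \esum_(p in [set: X]) (x p ^+ 2)%:E.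

Lemma esumsq_ge0 x : (0 <= esumsq x)%E.
Proof. by apply: esum_ge0 => p _; rewrite lee_fin sqr_ge0. Qed.

Lemma esumsq_le x (e : R) :
  (forall r : seq X, uniq r -> \sum_(p <- r) x p ^+ 2 <= e) -> (esumsq x <= e%:E)%E.
Proof.
move=> h; apply: ub_ereal_sup => _ [A [fA _] <-].
rewrite fsumEFin// lee_fin fsbig_finite//; apply: h; exact: finmap.fset_uniq.
Qed.

Lemma esumsq_ge x p : ((x p ^+ 2)%:E <= esumsq x)%E.
Proof.
apply: esum_ge; exists [set p]; first by split.
by rewrite fsbig_set1.
Qed.

Lemma esumsqZ a x : esumsq (fun p => a * x p) = ((a ^+ 2)%:E * esumsq x)%E.
Proof.
rewrite /esumsq /esum -ereal_supZl ?sqr_ge0//; last first.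
  by apply/set0P; exists (\sum_(p \in set0) (x p ^+ 2)%:E)%E, set0 => //; split.
congr ereal_sup; apply/seteqP; split=> [_ [A fA <-]|_ [_ [A fA <-] <-]] /=.
  exists (\sum_(p \in A) (x p ^+ 2)%:E)%E; first by exists A.
  rewrite ge0_mule_fsumr; last by move=> p; rewrite lee_fin sqr_ge0.
  by apply: eq_fsbigr => p _; rewrite exprMn EFinM.
exists A => //; rewrite ge0_mule_fsumr; last by move=> p; rewrite lee_fin sqr_ge0.
by apply: eq_fsbigr => p _; rewrite exprMn EFinM.
Qed.

Lemma esumsqD_le (x y : X -> R) :
  (esumsq (fun p => x p + y p)%R <= 2%:E * (esumsq x + esumsq y))%E.
Proof.
have -> : (2%:E * (esumsq x + esumsq y) = (esumsq x + esumsq y) + (esumsq x + esumsq y))%E.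
  rewrite (_ : 2 = 1 + 1)// EFinD ge0_muleDl ?mul1e//.
rewrite /esumsq -!esumD; try by move=> *; rewrite ?adde_ge0 ?lee_fin ?sqr_ge0.
apply: le_esum => p _; rewrite -!EFinD lee_fin.
by have := sqr_ge0 (x p - y p); lra.
Qed.

Definition l2_mem : {pred X -> R^o} := fun x => `[< (esumsq x < +oo)%E >].

Fact l2_mem_closed : submod_closed l2_mem.
Proof.
split=> [|a x y]; rewrite -!topredE/= /l2_mem.
  apply/asboolP; rewrite /esumsq esum1 ?ltry// => p _.
  by rewrite expr0n.
move=> /asboolP hx /asboolP hy; apply/asboolP.
apply: (le_lt_trans (esumsqD_le (fun p => a * x p) y)).
rewrite lte_mul_pinfty// ?lte_add_pinfty// esumsqZ.
by rewrite lte_mul_pinfty// lee_fin sqr_ge0.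
Qed.

HB.instance Definition _ :=
  GRing.isSubmodClosed.Build R (X -> R^o) l2_mem l2_mem_closed.

Definition l2 := {x : X -> R^o | x \in l2_mem}.

HB.instance Definition _ := SubChoice.on l2.
HB.instance Definition _ := [SubChoice_isSubLmodule of l2 by <:].

Definition mk_l2 (x : X -> R^o) (hx : x \in l2_mem) : l2 :=
  exist (fun x : X -> R^o => x \in l2_mem) x hx.

Lemma l2_valD (x y : l2) p : val (x + y) p = val x p + val y p :> R.
Proof. by []. Qed.

Lemma l2_valN (x : l2) p : val (- x) p = - val x p :> R.
Proof. by []. Qed.

Lemma l2_valZ a (x : l2) p : val (a *: x) p = a * val x p :> R.
Proof. by []. Qed.

Lemma l2P (x : l2) : (esumsq (val x) < +oo)%E.
Proof. by have /asboolP := valP x. Qed.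

Lemma l2_memP (x : X -> R^o) : (esumsq x < +oo)%E -> x \in l2_mem.
Proof. by move=> hx; apply/asboolP. Qed.

Definition normsq (x : l2) : R := fine (esumsq (val x)).

Lemma normsqE x : (normsq x)%:E = esumsq (val x).
Proof. by rewrite fineK// ge0_fin_numE ?esumsq_ge0// l2P. Qed.

Lemma normsq_ge0 x : 0 <= normsq x.
Proof. by rewrite fine_ge0// esumsq_ge0. Qed.

Lemma normsq_ge x p : val x p ^+ 2 <= normsq x.
Proof. by rewrite -lee_fin normsqE; exact: esumsq_ge. Qed.

Lemma normsqZ a x : normsq (a *: x) = a ^+ 2 * normsq x.
Proof.
apply: EFin_inj; rewrite EFinM !normsqE -esumsqZ.
by congr esumsq; apply/funext => p.
Qed.

Lemma normsq_comb (s : seq (R * l2)) : all (fun q => 0 <= q.1) s ->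
  (\sum_(q <- s) q.1 * normsq q.2)%:E =
  \esum_(p in [set: X]) (\sum_(q <- s) q.1 * val q.2 p ^+ 2)%:E.
Proof.
elim: s => [_|[a x] s IH /= /andP[a0 s0]].
  by rewrite big_nil esum1// => p _; rewrite big_nil.
rewrite big_cons EFinD IH// EFinM normsqE -[a in LHS]sqr_sqrtr// -esumsqZ -esumD.
- apply: eq_esum => p _; rewrite big_cons -EFinD; congr (_ + _)%:E.
  by rewrite exprMn sqr_sqrtr.
- by move=> p _; rewrite lee_fin sqr_ge0.
- move=> p _; rewrite lee_fin big_seq; apply: sumr_ge0 => q qs.
  by rewrite mulr_ge0 ?sqr_ge0//; exact: (allP s0).
Qed.

(* Quadratic identities that hold pointwise transfer to norms; both sides have
   nonnegative coefficients so that no infinite sum is subtracted. *)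
Lemma normsq_rel (a b : R) (x1 x2 x3 y1 y2 y3 y4 : l2) : 0 <= a -> 0 <= b ->
  (forall p, val x1 p ^+ 2 + val x2 p ^+ 2 + a * val x3 p ^+ 2 =
     val y1 p ^+ 2 + a * val y2 p ^+ 2 + a * val y3 p ^+ 2 + b * val y4 p ^+ 2) ->
  normsq x1 + normsq x2 + a * normsq x3 =
    normsq y1 + a * normsq y2 + a * normsq y3 + b * normsq y4.
Proof.
move=> a0 b0 xy.
have := @normsq_comb [:: (1, x1); (1, x2); (a, x3)].
have := @normsq_comb [:: (1, y1); (a, y2); (a, y3); (b, y4)].
rewrite !big_cons !big_nil /= a0 b0 ler01 !mul1r !addr0 !addrA.
move=> /(_ isT) hy /(_ isT) hx; apply: EFin_inj; rewrite hy hx.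
apply: eq_esum => p _; rewrite !big_cons !big_nil /= !mul1r !addr0 !addrA.
by rewrite xy.
Qed.

Fact l2_basis_mem p : ((fun q => (q == p)%:R) : X -> R^o) \in l2_mem.
Proof.
apply: l2_memP; rewrite /esumsq (esumID [set p]) => [|q _]; last first.
  by rewrite lee_fin sqr_ge0.
rewrite !setTI esum_set1 ?lee_fin ?sqr_ge0//.
rewrite [X in (_ + X)%E]esum1 ?adde0 ?ltry// => q /= /eqP/negPf ->.
by rewrite expr0n.
Qed.

Definition l2_basis p := mk_l2 (l2_basis_mem p).

Lemma normsq_basis p : normsq (l2_basis p) = 1.
Proof.
rewrite /normsq /esumsq (esumID [set p]) => [|q _]; last first.
  by rewrite lee_fin sqr_ge0.
rewrite !setTI esum_set1 ?lee_fin ?sqr_ge0//= eqxx expr1n.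
rewrite [X in (_ + X)%E]esum1 ?adde0// => q /= /eqP/negPf ->.
by rewrite expr0n.
Qed.

(** Polarisation expresses the inner product by norms, so that only infinite sums of nonnegative
    terms occur. *)
Definition ip2 (x y : l2) : R := (normsq x + normsq y - normsq (x - y)) / 2.

Lemma l2N x : normsq (- x) = normsq x.
Proof. by rewrite -scaleN1r normsqZ sqrrN expr1n mul1r. Qed.

Lemma ip2C x y : ip2 x y = ip2 y x.
Proof. by rewrite /ip2 -(l2N (x - y)) opprB [normsq x + _]addrC. Qed.

Lemma ip2xx x : ip2 x x = normsq x.
Proof.
by rewrite /ip2 subrr -(scale0r x) normsqZ expr0n mul0r; field.
Qed.

Lemma ip2Dl x y z : ip2 (x + y) z = ip2 x z + ip2 y z.
Proof.
suff : normsq (x + y) + normsq (x - z) + 1 * normsq (y - z) =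
    normsq (x + y - z) + 1 * normsq x + 1 * normsq y + 1 * normsq z.
  rewrite /ip2; move: (normsq (x + y)) (normsq (x - z)) (normsq (y - z)).
  move: (normsq (_ - z)) (normsq x) (normsq y) (normsq z) => n1 n2 n3 n4 n5 n6 n7.
  by lra.
by apply: normsq_rel => // p; rewrite !(l2_valD, l2_valN); ring.
Qed.

Lemma ip2Nl x y : ip2 (- x) y = - ip2 x y.
Proof.
have h0 : ip2 0 y = 0.
  by have := ip2Dl 0 0 y; rewrite addr0; move: (ip2 0 y) => n; lra.
by apply/eqP; rewrite -addr_eq0 -ip2Dl addNr h0.
Qed.

Lemma ip2Zl a x y : ip2 (a *: x) y = a * ip2 x y.
Proof.
(* [normsq_rel] accepts only nonnegative coefficients. *)
wlog a0 : a / 0 <= a => [h|].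
  have [/h//|a0] := leP 0 a.
  have := h (- a); rewrite oppr_ge0 ltW// => /(_ isT).
  by rewrite scaleNr ip2Nl mulNr => /oppr_inj.
(* The vanishing last term only pads the identity to the shape of [normsq_rel]. *)
suff : normsq (a *: x) + normsq y + a * normsq (x - y) =
    normsq (a *: x - y) + a * normsq x + a * normsq y + 0 * normsq 0.
  rewrite /ip2; move: (normsq (a *: x)) (normsq (x - y)) (normsq (_ - y)).
  move: (normsq x) (normsq y) (normsq 0) => n1 n2 n3 n4 n5 n6 h.
  rewrite mulrA; congr (_ / 2); lra.
by apply: normsq_rel => // p; rewrite !(l2_valD, l2_valN, l2_valZ); ring.
Qed.

Lemma ip2P a x y z : ip2 (a *: x + y) z = a * ip2 x z + ip2 y z.
Proof. by rewrite ip2Dl ip2Zl. Qed.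

Lemma ip2_ge0 x : 0 <= ip2 x x.
Proof. by rewrite ip2xx normsq_ge0. Qed.

Lemma ip2_eq0 x : ip2 x x = 0 -> x = 0.
Proof.
rewrite ip2xx => x0; apply/val_inj/funext => p; apply/eqP.
by rewrite -sqrf_eq0 eq_le sqr_ge0 andbT -x0 normsq_ge.
Qed.

Lemma ip2_basis x p : ip2 x (l2_basis p) = val x p.
Proof.
wlog x0 : x / 0 <= val x p => [h|].
  have [/h//|x0] := leP 0 (val x p).
  by have := h (- x); rewrite ip2Nl l2_valN oppr_ge0 ltW// => /(_ isT)/oppr_inj.
suff : normsq x + normsq (l2_basis p) + 0 * normsq 0 =
    normsq (x - l2_basis p) + 0 * normsq 0 + 0 * normsq 0 +
    (2 * val x p) * normsq (l2_basis p).
  rewrite /ip2 normsq_basis; move: (normsq x) (normsq (x - _)) (normsq 0) (val x p).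
  by move=> n1 n2 n3 v h; lra.
apply: normsq_rel => //; first exact: mulr_ge0.
move=> q; rewrite l2_valD l2_valN /=.
by case: eqVneq => [->|_] /=; ring.
Qed.

(** The pointwise limit is the norm limit: on each finite set of points the Cauchy bound survives
    letting [m] tend to infinity, and it does not depend on the finite set. *)
Lemma l2_complete (u : nat -> l2) :
  (forall e : R, 0 < e -> exists N, forall m n, (N <= m)%N -> (N <= n)%N ->
     ip2 (u m - u n) (u m - u n) <= e) ->
  exists l, forall e : R, 0 < e -> exists N, forall n, (N <= n)%N ->
     ip2 (u n - l) (u n - l) <= e.
Proof.
move=> cu.
have cvp p : cvgn (fun n => val (u n) p : R).
  apply/cauchy_cvgP/cauchy_exP => e e0.
  have [N hN] := cu (e ^+ 2 / 4) ltac:(by rewrite divr_gt0// exprn_gt0).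
  exists (val (u N) p : R), N => // n Nn; rewrite /= /ball /=.
  have := normsq_ge (u N - u n) p; have := hN _ _ (leqnn N) Nn.
  rewrite ip2xx => /[swap] /le_trans /[apply] h.
  have he : (val (u N) p - val (u n) p) ^+ 2 < e ^+ 2.
    apply: le_lt_trans h _; have : 0 < e ^+ 2 by exact: exprn_gt0.
    by move: (e ^+ 2) => e2; lra.
  by rewrite -(ltr_pXn2r (n := 2))// ?nnegrE ?ltW// real_normK ?num_real.
pose l p : R^o := limn (fun n => val (u n) p : R).
have tail (e : R) : 0 < e -> exists N, forall n, (N <= n)%N ->
    (esumsq (fun p => val (u n) p - l p)%R <= e%:E)%E.
  move=> e0; have [N hN] := cu _ e0; exists N => n Nn.
  apply: esumsq_le => r ur.
  have cv : (fun m => \sum_(p <- r) (val (u n) p - val (u m) p) ^+ 2 : R) @ \oo -->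
      (\sum_(p <- r) (val (u n) p - l p) ^+ 2 : R).
    apply: cvg_big => [|p _]; first exact: add_continuous.
    rewrite expr2; under eq_cvg do rewrite expr2.
    by apply: cvgM; apply: cvgB; [exact: cvg_cst|exact: cvp|exact: cvg_cst|exact: cvp].
  apply: (cvgr_to_le cv); exists N => // m /= Nm.
  have := hN _ _ Nn Nm; rewrite ip2xx; apply: le_trans.
  rewrite -lee_fin normsqE; apply: esum_ge; exists [set` r].
    by split=> //; exact: finite_seq.
  by rewrite fsumEFin ?finite_seq// lee_fin -fsbig_seq.
have lm : l \in l2_mem.
  have [N hN] := tail 1 ltr01; apply: l2_memP.
  (* The limit is [u N] minus the tail [u N - l], and both are square-summable. *)
  rewrite (_ : l = fun p => (-1) * (val (u N) p - l p) + val (u N) p); last first.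
    by apply/funext => p; rewrite mulN1r opprB subrK.
  apply: (le_lt_trans (esumsqD_le _ _)).
  rewrite lte_mul_pinfty//; apply: lte_add_pinfty; last exact: l2P.
  rewrite esumsqZ sqrrN expr1n mul1e.
  exact: (le_lt_trans (hN N (leqnn N)) (ltry _)).
exists (mk_l2 lm) => e e0; have [N hN] := tail _ e0; exists N => n Nn.
by rewrite ip2xx -lee_fin normsqE; exact: hN.
Qed.

End RealEllTwo.

(** * Chains on the Cayley graph *)

Definition generates (G : groupType) (d : nat) (gen : 'I_d -> G) :=
  forall K : groupClosed G, (forall j, gen j \in K) -> forall g, g \in K.

Lemma finitely_generatedP (G : groupType) :
  finitely_generated G -> exists d (gen : 'I_d -> G), generates gen.
Proof.
case=> s hs; exists (size s), (fun j => nth 1%g s j) => K hK; apply: hs => x xs.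
have xi : (index x s < size s)%N by rewrite index_mem.
by have := hK (Ordinal xi); rewrite /= nth_index.
Qed.

Lemma generates_ind (G : groupType) d (gen : 'I_d -> G) (Q : G -> Prop) :
  generates gen -> Q 1%g -> (forall x y, Q x -> Q y -> Q (x * y)%g) ->
  (forall x, Q x -> Q (x^-1)%g) -> (forall j, Q (gen j)) -> forall g, Q g.
Proof.
move=> hgen Q1 QM QV Qgen g; pose S : {pred G} := fun g => `[< Q g >].
have SE x : (x \in S) = `[< Q x >] by [].
have S1 : 1%g \in S by rewrite SE; apply/asboolP.
have SM : {in S &, forall x y, (x * y)%g \in S}.
  by move=> x y; rewrite !SE => /asboolP ? /asboolP ?; apply/asboolP; exact: QM.
have SV : {in S, forall x, (x^-1)%g \in S}.
  by move=> x; rewrite !SE => /asboolP ?; apply/asboolP; exact: QV.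
pose K : groupClosed G := HB.pack S (isMulClosed.Build G S SM)
  (isMul1Closed.Build G S S1) (isInvClosed.Build G S SV).
have : g \in K by apply: hgen => j; rewrite SE; apply/asboolP.
by move=> /asboolP.
Qed.

Section Chains.
Variables (R : comRingType) (X : choiceType).
Implicit Types (c : seq (R * X)) (F : X -> R).

(* Chains are formal sums, given as lists of pairs (coefficient, point). *)
Definition chain_pair c F : R := \sum_(p <- c) p.1 * F p.2.

Definition chain_scale (a : R) c := [seq (a * p.1, p.2) | p <- c].
Definition chain_map Y (f : X -> Y) c : seq (R * Y) := [seq (p.1, f p.2) | p <- c].

Lemma chain_pair_nil F : chain_pair [::] F = 0.
Proof. by rewrite /chain_pair big_nil. Qed.

Lemma chain_pair_cons p c F : chain_pair (p :: c) F = p.1 * F p.2 + chain_pair c F.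
Proof. by rewrite /chain_pair big_cons. Qed.

Lemma chain_pair_cat c1 c2 F : chain_pair (c1 ++ c2) F = chain_pair c1 F + chain_pair c2 F.
Proof. by rewrite /chain_pair big_cat. Qed.

Lemma chain_pair_scale a c F : chain_pair (chain_scale a c) F = a * chain_pair c F.
Proof.
by rewrite /chain_pair big_map mulr_sumr; apply: eq_bigr => p _; rewrite mulrA.
Qed.

End Chains.

Lemma chain_pair_map (R : comRingType) (X Y : choiceType) (f : X -> Y)
  (c : seq (R * X)) F : chain_pair (chain_map f c) F = chain_pair c (F \o f).
Proof. by rewrite /chain_pair big_map. Qed.

Section Edges.
Variables (R : comRingType) (G : groupType) (d : nat) (gen : 'I_d -> G).

(* (g, j) is the edge of the Cayley graph from g to g * gen j. *)
Definition edge : choiceType := (G * 'I_d)%type.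

Definition eact (g : G) (x : edge) : edge := ((g * x.1)%g, x.2).

Lemma eactK g : cancel (eact g) (eact g^-1%g).
Proof. by case=> h j; rewrite /eact /= mulKg. Qed.

Lemma eactVK g : cancel (eact g^-1%g) (eact g).
Proof. by case=> h j; rewrite /eact /= mulVKg. Qed.

Definition grad (f : G -> R) (x : edge) : R := f (x.1 * gen x.2)%g - f x.1.

Definition divergence_free (F : edge -> R) := forall h : G,
  \sum_j (F ((h * (gen j)^-1)%g, j) - F (h, j)) = 0.

Definition harmonic_form (F : edge -> R) :=
  (exists f, F =1 grad f) /\ divergence_free F.

(* These are the sums of a cycle and a coboundary. *)
Definition kills_harmonic (c : seq (R * edge)) :=
  forall F, harmonic_form F -> chain_pair c F = 0.

Lemma harmonic_form_act g F : harmonic_form F -> harmonic_form (F \o eact g).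
Proof.
case=> -[f Ff] dF; split; first by exists (fun h => f (g * h)%g) => x;
  rewrite /= Ff /grad /eact /= mulgA.
by move=> h; rewrite -[RHS](dF (g * h)%g); apply: eq_bigr => j _; rewrite /= /eact /= mulgA.
Qed.

Lemma kills_harmonic_act g c : kills_harmonic c -> kills_harmonic (chain_map (eact g) c).
Proof. by move=> kc F hF; rewrite chain_pair_map; apply/kc/harmonic_form_act. Qed.

Lemma grad_act g f : grad f \o eact g = grad (fun h => f (g * h)%g).
Proof. by apply/funext => x; rewrite /= /grad /= mulgA. Qed.

(** The chain is a path from 1 to [g], remembered only through its pairing with gradients. *)
Lemma path_chain : generates gen -> forall g, exists c : seq (R * edge),
  forall f, chain_pair c (grad f) = f g - f 1%g.
Proof.
move=> hgen; apply: (generates_ind hgen) => [|x y [cx hx] [cy hy]|x [c hc]|j].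
- by exists [::] => f; rewrite chain_pair_nil subrr.
- exists (cx ++ chain_map (eact x) cy) => f; rewrite chain_pair_cat chain_pair_map hx.
  rewrite grad_act hy mulg1 addrC addrA subrK//.
(* Reverse the path to [x] and translate it by [x^-1], so that it starts at 1. *)
- exists (chain_scale (-1) (chain_map (eact x^-1%g) c)) => f.
  rewrite chain_pair_scale chain_pair_map.
  by rewrite grad_act hc mulVg mulg1 mulN1r opprB.
- exists [:: (1, (1%g, j))] => f.
  by rewrite chain_pair_cons chain_pair_nil addr0 mul1r /grad /= mul1g.
Qed.

End Edges.

(** * The equivariant harmonic projection *)

Section HarmonicProjection.
Variables (R : realType) (G : groupType) (d : nat) (gen : 'I_d -> G).
Local Notation edge := (edge G d).
Local Notation L := (l2 R edge).
Implicit Types (u v : L) (c : seq (R * edge)).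

Definition chain_l2 c : L := \sum_(p <- c) p.1 *: l2_basis R p.2.

Lemma chain_l2_nil : chain_l2 [::] = 0.
Proof. by rewrite /chain_l2 big_nil. Qed.

Lemma chain_l2_cat c1 c2 : chain_l2 (c1 ++ c2) = chain_l2 c1 + chain_l2 c2.
Proof. by rewrite /chain_l2 big_cat. Qed.

Lemma chain_l2_scale a c : chain_l2 (chain_scale a c) = a *: chain_l2 c.
Proof.
by rewrite /chain_l2 big_map scaler_sumr; apply: eq_bigr => p _; rewrite scalerA.
Qed.

Lemma ip2_chain u c : ip2 u (chain_l2 c) = chain_pair c (val u).
Proof.
rewrite ip2C /chain_l2 /chain_pair; elim: c => [|p c IH].
  by rewrite !big_nil; exact: (ip0l (@ip2P _ _)).
by rewrite !big_cons ip2P IH ip2C ip2_basis.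
Qed.

Lemma ip2_chain2 c1 c2 : ip2 (chain_l2 c1) (chain_l2 c2) =
  \sum_(p <- c1) \sum_(q <- c2) p.1 * q.1 * (p.2 == q.2)%:R.
Proof.
rewrite ip2C ip2_chain /chain_pair; apply: eq_bigr => p _.
rewrite -ip2_basis ip2C ip2_chain /chain_pair mulr_sumr; apply: eq_bigr => q _.
by rewrite mulrA eq_sym.
Qed.

Definition nonharmonic : set L :=
  [set u | exists2 c, kills_harmonic gen c & u = chain_l2 c].

Lemma nonharmonic_submod : is_submod nonharmonic.
Proof.
split; first by exists [::]; [move=> F _; rewrite chain_pair_nil|rewrite chain_l2_nil].
move=> a _ _ [c1 k1 ->] [c2 k2 ->]; exists (chain_scale a c1 ++ c2).
  by move=> F hF; rewrite chain_pair_cat chain_pair_scale k1// k2// mulr0 addr0.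
by rewrite chain_l2_cat chain_l2_scale.
Qed.

(* Locked, because comparing projections up to conversion is very slow. *)
Definition hproj : L -> L := locked (ortho_proj (@ip2C R edge) (@ip2P R edge)
  (@ip2_ge0 R edge) (@l2_complete R edge) nonharmonic_submod).

Fact edge_shift_mem g u : (val u \o eact g^-1%g : edge -> R^o) \in @l2_mem R edge.
Proof.
apply: l2_memP; rewrite /esumsq; have := l2P u; rewrite /esumsq.
rewrite (@reindex_esum _ _ _ [set: edge] [set: edge] (eact g^-1%g) (fun x => (val u x ^+ 2)%:E))//.
by rewrite setTT_bijective; exists (eact g); [exact: eactVK|exact: eactK].
Qed.

Definition edge_shift g u : L := mk_l2 (edge_shift_mem g u).

Lemma edge_shift_linear g a u v : edge_shift g (a *: u + v) = a *: edge_shift g u + edge_shift g v.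
Proof. exact/val_inj. Qed.

Lemma edge_shiftB g u v : edge_shift g (u - v) = edge_shift g u - edge_shift g v.
Proof. exact/val_inj. Qed.

Lemma edge_shiftK g : cancel (edge_shift g) (edge_shift g^-1%g).
Proof. by move=> u; apply/val_inj/funext => x /=; rewrite invgK eactK. Qed.

Lemma normsq_shift g u : normsq (edge_shift g u) = normsq u.
Proof.
rewrite /normsq; congr fine; rewrite /esumsq.
rewrite [RHS](@reindex_esum _ _ _ [set: edge] [set: edge] (eact g^-1%g))//.
by rewrite setTT_bijective; exists (eact g); [exact: eactVK|exact: eactK].
Qed.

Lemma ip2_shift g u v : ip2 (edge_shift g u) (edge_shift g v) = ip2 u v.
Proof. by rewrite /ip2 -edge_shiftB !normsq_shift. Qed.

Lemma edge_shift_basis g x : edge_shift g (l2_basis R x) = l2_basis R (eact g x).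
Proof.
apply/val_inj/funext => y /=; congr (_%:R).
by rewrite (can2_eq (eactVK g) (eactK g)).
Qed.

Lemma edge_shift_chain g c : edge_shift g (chain_l2 c) = chain_l2 (chain_map (eact g) c).
Proof.
rewrite /chain_l2; elim: c => [|p c IH].
  by rewrite !big_nil; exact/val_inj.
by rewrite !big_cons edge_shift_linear IH edge_shift_basis.
Qed.

Lemma edge_shift_nonharmonic g u : nonharmonic u -> nonharmonic (edge_shift g u).
Proof.
case=> c kc ->; rewrite edge_shift_chain; exists (chain_map (eact g) c) => //.
exact: kills_harmonic_act.
Qed.

(** Translations are isometries that preserve [nonharmonic], so the translated projection satisfies
    the characterisation of the projection of the translate. *)
Lemma hproj_shift g u : hproj (edge_shift g u) = edge_shift g (hproj u).
Proof.
rewrite /hproj -lock; apply: ortho_proj_unique; first exact: ip2_eq0.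
  move=> b Bb; rewrite -(ip2_shift g^-1%g) edge_shiftK.
  by apply: ortho_proj_orthogonal; exact: edge_shift_nonharmonic.
move=> e e0; have [b Bb hb] := ortho_proj_closure (@ip2C R edge) (@ip2P R edge)
  (@ip2_ge0 R edge) (@l2_complete R edge) nonharmonic_submod u e0.
exists (edge_shift g b); first exact: edge_shift_nonharmonic.
by rewrite -!edge_shiftB ip2_shift.
Qed.

Lemma hproj_linear a u v : hproj (a *: u + v) = a *: hproj u + hproj v.
Proof. by rewrite /hproj -lock; apply: ortho_proj_is_linear; exact: ip2_eq0. Qed.

Lemma hproj_idem u : hproj (hproj u) = hproj u.
Proof.
rewrite /hproj -lock; apply: ortho_proj_id; first exact: ip2_eq0.
exact: ortho_proj_orthogonal.
Qed.

Lemma hproj_kills c : kills_harmonic gen c -> hproj (chain_l2 c) = 0.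
Proof.
by move=> kc; rewrite /hproj -lock; apply: ortho_proj0; [exact: ip2_eq0|exists c]. Qed.

Lemma hproj_le u : normsq (hproj u) <= normsq u.
Proof. by rewrite /hproj -lock -!ip2xx; exact: ortho_proj_le. Qed.

Lemma hproj_approx x (e : R) : 0 < e -> exists c, kills_harmonic gen c /\
  normsq (l2_basis R x - chain_l2 c) <= val (hproj (l2_basis R x)) x + e.
Proof.
move=> e0; have [_ [c kc ->]] := ortho_proj_approx (@ip2C R edge) (@ip2P R edge)
  (@ip2_ge0 R edge) (@l2_complete R edge) nonharmonic_submod (l2_basis R x) e0.
by rewrite ip2xx ip2_basis /hproj -lock => h; exists c.
Qed.

Hypothesis hgen : generates gen.

(* Integrating along paths is consistent, since u is orthogonal to all cycles. *)
Lemma hproj_grad u : exists f, val (hproj u) =1 grad gen f.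
Proof.
pose c g := projT1 (cid (path_chain R hgen g)).
have cP g f : chain_pair (c g) (grad gen f) = f g - f 1%g by rewrite /c; case: cid.
exists (fun g => chain_pair (c g) (val (hproj u))) => -[g j].
pose z := c (g * gen j)%g ++ chain_scale (-1) ([:: (1, (g, j))] ++ c g).
have kz : kills_harmonic gen z.
  move=> F [[f /funext ->] _]; rewrite chain_pair_cat chain_pair_scale chain_pair_cat !cP.
  by rewrite chain_pair_cons chain_pair_nil /grad /=; ring.
have : chain_pair z (val (hproj u)) = 0.
  by rewrite -ip2_chain /hproj -lock; apply: ortho_proj_orthogonal; exists z.
rewrite chain_pair_cat chain_pair_scale chain_pair_cat chain_pair_cons.
rewrite chain_pair_nil /grad /= addr0 mul1r mulN1r => /subr0_eq ->.
by rewrite addrK.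
Qed.

End HarmonicProjection.

(** * Finite quotients *)

Section TraceBound.
Variable F : realFieldType.

Lemma mxtrace_mulmx_tr m n (A : 'M[F]_(m, n)) :
  \tr (A *m A^T) = \sum_i \sum_j A i j ^+ 2.
Proof.
apply: eq_bigr => i _; rewrite mxE; apply: eq_bigr => j _.
by rewrite mxE expr2.
Qed.

Lemma mulmx_tr_eq0 n (u : 'rV[F]_n) : u *m u^T = 0 -> u = 0.
Proof.
move=> /(congr1 (fun A => \tr A)); rewrite mxtrace_mulmx_tr mxtrace0 big_ord1.
move/eqP; rewrite psumr_eq0 => [/allP h|j _]; last exact: sqr_ge0.
apply/rowP => j; rewrite mxE; apply/eqP; rewrite -sqrf_eq0.
by apply: (implyP (h j _)); rewrite ?mem_index_enum.
Qed.

(** If [u] is killed by the Gram matrix, then [u *m H] has norm zero; over an ordered field it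
    vanishes. *)
Lemma gram_unitmx r k (H : 'M[F]_(r, k)) : row_free H -> H *m H^T \in unitmx.
Proof.
move=> rH; rewrite -row_free_unit -kermx_eq0; apply/eqP/row_matrixP => i.
rewrite row0; have : row i (kermx (H *m H^T)) *m (H *m H^T) = 0.
  by rewrite -row_mul mulmx_ker row0.
set u := row i _ => h; apply: (row_free_inj rH); rewrite mul0mx.
by apply: mulmx_tr_eq0; rewrite trmx_mul mulmxA -(mulmxA u) h mul0mx.
Qed.

(* D fixes the column space of H^T; compare its Hilbert-Schmidt norm with that of
   the orthogonal projection onto this space. *)
Lemma dim_le_sqnorm r k (H : 'M[F]_(r, k)) (D : 'M[F]_k) :
  row_free H -> D *m H^T = H^T -> r%:R <= \sum_i \sum_j D i j ^+ 2.
Proof.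
move=> rH DH; pose M := invmx (H *m H^T); pose P := H^T *m M *m H.
have uG := gram_unitmx rH.
have PP : P *m P = P.
  rewrite /P !mulmxA -(mulmxA _ H H^T) -(mulmxA H^T M (H *m H^T)).
  by rewrite (mulVmx uG) mulmx1.
have PT : P^T = P.
  by rewrite /P !trmx_mul trmxK /M trmx_inv trmx_mul trmxK mulmxA.
have DP : D *m P = P by rewrite /P !mulmxA DH.
have trP : \tr P = r%:R.
  by rewrite /P mxtrace_mulC mulmxA (mulmxV uG) mxtrace1.
rewrite -mxtrace_mulmx_tr.
have -> : D *m D^T = (D *m (1%:M - P)) *m (D *m (1%:M - P))^T + D *m P *m D^T.
  have QT : (1%:M - P)^T = 1%:M - P by rewrite linearB /= trmx1 PT.
  have QQ : (1%:M - P) *m (1%:M - P) = 1%:M - P.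
    by rewrite mulmxBr mulmx1 mulmxBl mul1mx PP subrr subr0.
  rewrite trmx_mul QT mulmxA -(mulmxA D) QQ -mulmxDl -mulmxDr subrK.
  by rewrite mulmx1.
have -> : D *m P *m D^T = (D *m P)^T by rewrite trmx_mul PT DP.
rewrite mxtraceD mxtrace_tr DP trP.
rewrite lerDr mxtrace_mulmx_tr.
by apply: sumr_ge0 => i _; apply: sumr_ge0 => j _; exact: sqr_ge0.
Qed.

End TraceBound.

Section SubspaceMatrix.
Variables (F : fieldType) (k : nat) (Q : set 'rV[F]_k).

(** Among the row spaces contained in [Q], one of maximal rank absorbs every vector of [Q]. *)
Lemma submod_row_space : is_submod Q ->
  exists U : 'M[F]_k, forall u : 'rV[F]_k, (u <= U)%MS <-> Q u.
Proof.
case=> Q0 QZ.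
pose good (U : 'M[F]_k) := forall u : 'rV[F]_k, (u <= U)%MS -> Q u.
pose p r := `[< exists U, good U /\ \rank U = r >].
have ex : exists r, p r.
  exists 0%N; apply/asboolP; exists 0; rewrite mxrank0; split=> // u.
  by rewrite submx0 => /eqP->.
have ub r : p r -> (r <= k)%N.
  by move=> /asboolP [U [_ <-]]; exact: rank_leq_row.
case: (ex_maxnP ex ub) => r /asboolP [U [gU rU]] hmax; exists U => u.
split=> [|Qu]; first exact: gU.
have gUu : good (U + <<u>>)%MS.
  move=> v /sub_addsmxP [[a b] /= ->]; rewrite addrC.
  have : (b *m <<u>> <= u)%MS by rewrite (submx_trans (submxMl _ _))// genmxE.
  by case/sub_rVP => t ->; apply: QZ => //; apply: gU; exact: submxMl.
have := hmax _ (introT (asboolP _) (ex_intro _ _ (conj gUu erefl))).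
rewrite -rU => h.
have /andP[_ UuU] : (U == U + <<u>>)%MS.
  by rewrite -(geq_leqif (mxrank_leqif_eq (addsmxSl _ _))).
apply: submx_trans UuU; apply: (@submx_trans _ _ _ _ _ _ <<u>>%MS).
  by rewrite genmxE.
exact: addsmxSr.
Qed.

End SubspaceMatrix.

Lemma sum_enum_rank (V : nmodType) (E : finType) (F : 'I_#|E| -> V) :
  \sum_c F c = \sum_(e : E) F (enum_rank e).
Proof. exact: (reindex _ (onW_bij _ (enum_rank_bij E))). Qed.

(** * From rational homology of a subgroup to harmonic forms on its coset graph *)

Section CosetEdges.
Variables (G : groupType) (d : nat) (gen : 'I_d -> G) (K : groupClosed G).
Hypothesis hgen : generates gen.
Variables (m : nat) (q : G -> 'I_m) (t : 'I_m -> G).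
Hypothesis tK : cancel t q.
Hypothesis qP : forall g h, q g = q h <-> (g * h^-1)%g \in K.

Local Notation E := ('I_m * 'I_d)%type.
Local Notation k := #|{: E}|.

(* A row vector indexed by the edges of the quotient graph, lifted to the Cayley
   graph of G. *)
Definition edge_lift (F : comRingType) (u : 'rV[F]_k) (x : edge G d) : F :=
  u 0 (enum_rank (q x.1, x.2)).

Lemma coset_mulr g h s : q g = q h -> q (g * s)%g = q (h * s)%g.
Proof. by rewrite !qP mulgKA. Qed.

Lemma coset_mulr_t g s : q (t (q g) * s)%g = q (g * s)%g.
Proof. by apply: coset_mulr; rewrite tK. Qed.

Lemma coset_mull g h : g \in K -> q (g * h)%g = q h.
Proof. by move=> gK; apply/qP; rewrite mulgK. Qed.

Lemma coset_repr_mem g : (g * (t (q g))^-1)%g \in K.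
Proof. by apply/qP; rewrite tK. Qed.

(** [V] stands for H_1(K;Q), and [b] extends the map from [K] to [V] to all of [G], up to the
    constant [b 1]. It is not periodic, but its gradient is. *)
Variables (V : lmodType rat) (b : G -> V).
Hypothesis bM : forall x g, x \in K -> b (x * g)%g = b x - b 1%g + b g.
Hypothesis b_span : forall Q : set V, is_submod Q ->
  (forall x, x \in K -> Q (b x - b 1%g)) -> forall v, Q v.

Let theta (e : E) : V := b (t e.1 * gen e.2)%g - b (t e.1).

Let theta_q g j : theta (q g, j) = b (g * gen j)%g - b g.
Proof.
have gK := coset_repr_mem g; rewrite -[g in RHS](mulgVK (t (q g))) -mulgA.
by rewrite !(bM _ gK) /theta /= opprD addrACA subrr add0r.
Qed.

Let Theta (u : 'rV[rat]_k) : V := \sum_(e : E) u 0 (enum_rank e) *: theta e.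

Let ThetaP a u v : Theta (a *: u + v) = a *: Theta u + Theta v.
Proof.
rewrite /Theta scaler_sumr -big_split; apply: eq_bigr => e _ /=.
by rewrite !mxE scalerDl scalerA.
Qed.

Let Theta0 : Theta 0 = 0.
Proof. by rewrite /Theta big1// => e _; rewrite mxE scale0r. Qed.

Let ThetaD u v : Theta (u + v) = Theta u + Theta v.
Proof. by rewrite -[u]scale1r ThetaP !scale1r. Qed.

Let ThetaZ a u : Theta (a *: u) = a *: Theta u.
Proof. by rewrite -[a *: u]addr0 ThetaP Theta0 addr0. Qed.

Let ThetaN u : Theta (- u) = - Theta u.
Proof. by rewrite -[- u]scaleN1r ThetaZ scaleN1r. Qed.

Let Theta_delta e : Theta (delta_mx 0 (enum_rank e)) = theta e.
Proof.
rewrite /Theta (bigD1 e)//= !mxE !eqxx scale1r big1 ?addr0// => e' ne.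
by rewrite !mxE eqxx (inj_eq enum_rank_inj) (negPf ne) scale0r.
Qed.

(** The sums of [theta] along paths telescope to differences of values of [b], and these span
    [V]. *)
Let Theta_surj v : exists u, Theta u = v.
Proof.
have key g : forall h, exists u, Theta u = b (h * g)%g - b h.
  move: g; apply: (generates_ind hgen) => [h|x y IHx IHy h|x IH h|j h].
  - by exists 0; rewrite Theta0 mulg1 subrr.
  - have [u hu] := IHx h; have [w hw] := IHy (h * x)%g; exists (w + u).
    by rewrite ThetaD hu hw mulgA addrA subrK.
  - have [u hu] := IH (h * x^-1)%g; exists (- u).
    by rewrite ThetaN hu mulgVK opprB.
  - by exists (delta_mx 0 (enum_rank (q h, j))); rewrite Theta_delta theta_q.
move: v; apply: (b_span (Q := [set v | exists u, Theta u = v])) => [|x _].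
  split; first by exists 0; rewrite Theta0.
  by move=> a _ _ [u <-] [w <-]; exists (a *: u + w); rewrite ThetaP.
by have [u hu] := key x 1%g; exists u; rewrite hu mul1g.
Qed.

Let dot (a u : 'rV[rat]_k) : rat := (a *m u^T) 0 0.

Let dotP a c u v : dot a (c *: u + v) = c * dot a u + dot a v.
Proof. by rewrite /dot linearP /= linearP /= !mxE. Qed.

Let dotB a u v : dot a (u - v) = dot a u - dot a v.
Proof. by rewrite /dot linearB /= mulmxBr !mxE. Qed.

Let dot_delta a e : dot a (delta_mx 0 (enum_rank e)) = a 0 (enum_rank e).
Proof. by rewrite /dot trmx_delta -colE mxE. Qed.

(** The coboundary matrix of the coset graph: its row space consists of the gradients of periodic
    functions, and the kernel of its transpose of the divergence-free vectors. *)
Let D0 : 'M[rat]_(m, k) := \matrix_(i, c)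
  ((q (t (enum_val c).1 * gen (enum_val c).2)%g == i)%:R - ((enum_val c).1 == i)%:R).

Let D0_lift (y : 'rV[rat]_m) : edge_lift (y *m D0) =1 grad gen (fun g => y 0 (q g)).
Proof.
case=> g j; rewrite /edge_lift mxE /grad /=.
under eq_bigr do rewrite mxE enum_rankK /= mulrBr coset_mulr_t.
rewrite sumrB; congr (_ - _).
  by rewrite (bigD1 (q (g * gen j)%g))//= eqxx mulr1 big1 ?addr0// => i /negPf ni;
    rewrite eq_sym ni mulr0.
by rewrite (bigD1 (q g))//= eqxx mulr1 big1 ?addr0// => i /negPf ni;
  rewrite eq_sym ni mulr0.
Qed.

Let D0_ker_divergence (w : 'rV[rat]_k) : w *m D0^T = 0 ->
  divergence_free gen (edge_lift w).
Proof.
move=> /rowP wD h; have := wD (q h); rewrite mxE [RHS]mxE sum_enum_rank /=.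
under eq_bigr do rewrite !mxE enum_rankK mulrBr.
rewrite sumrB => /subr0_eq e; rewrite sumrB; apply/eqP; rewrite subr_eq0; apply/eqP.
have pairsum (F : E -> rat) : \sum_(e : E) F e = \sum_j \sum_i F (i, j).
  by rewrite exchange_big pair_big; apply: eq_bigr => -[].
move: e; rewrite !pairsum /= => e; transitivity
    (\sum_j \sum_i w 0 (enum_rank (i, j)) * (q (t i * gen j)%g == q h)%:R).
  (* Right multiplication by [gen j] permutes the cosets, so exactly one edge with label [j] ends at
     [q h]. *)
  apply: eq_bigr => j _; rewrite (bigD1 (q (h * (gen j)^-1)%g))//=.
  rewrite coset_mulr_t mulgVK eqxx mulr1 big1 ?addr0// => i ni.
  case: eqVneq => [e'|]; last by rewrite mulr0.
  case/eqP: ni; rewrite -(tK i) -(mulgK (gen j) (t i)); exact: coset_mulr.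
rewrite e; apply: eq_bigr => j _; rewrite (bigD1 (q h))//= eqxx mulr1.
by rewrite big1 ?addr0// => i /negPf ->; rewrite mulr0.
Qed.

Variables (n : nat) (f : {linear 'rV[rat]_n -> V}).
Hypothesis f_inj : injective f.

(** A Hodge decomposition by counting ranks. The space [A] of functionals on [V] composed with
    [theta] consists of vectors whose lifts are gradients; correcting them by periodic gradients
    makes them divergence-free without loss of dimension. *)
Lemma harmonic_edges : exists r (H : 'M[rat]_(r, k)), [/\ (n <= r)%N, row_free H &
  forall i, harmonic_form gen (edge_lift (row i H))].
Proof.
have [|U UP] := @submod_row_space _ k [set u | Theta u = 0].
  split=> [|a u v /= hu hv]; first exact: Theta0.
  by rewrite ThetaP hu hv scaler0 addr0.
pose A := kermx U^T.
have AP a : (a <= A)%MS -> forall u, Theta u = 0 -> dot a u = 0.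
  move=> /sub_kermxP aU u /UP/submxP [w ->].
  by rewrite /dot trmx_mul mulmxA aU mul0mx mxE.
(* Preimages under [Theta] of the images under [f] of the basis vectors are independent modulo the
   kernel [U], because [f] is injective; [A] is the annihilator of [U]. *)
have nA : (n <= \rank A)%N.
  rewrite mxrank_ker mxrank_tr leq_subRL ?rank_leq_row// addnC.
  pose v i := projT1 (cid (Theta_surj (f (delta_mx 0 i)))).
  have vP i : Theta (v i) = f (delta_mx 0 i) by rewrite /v; case: cid.
  pose Vm := \matrix_(i < n) v i.
  have VmP x : Theta (x *m Vm) = f x.
    rewrite [x in RHS]row_sum_delta linear_sum mulmx_sum_row.
    elim/big_rec2: _ => [|i y z _ <-]; first exact: Theta0.
    by rewrite ThetaP rowK vP linearZ.
  have rV : row_free Vm.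
    apply: inj_row_free => x x0; apply: f_inj.
    by rewrite -VmP x0 Theta0 linear0.
  have dis : (Vm :&: U = 0)%MS.
    apply/eqP/rowV0P => w; rewrite sub_capmx => /andP[/submxP [x ->] /UP xU].
    suff -> : x = 0 by rewrite mul0mx.
    by apply: f_inj; rewrite -VmP xU linear0.
  by rewrite -(eqP rV) -mxrank_disjoint_sum// rank_leq_row.
pose w g := projT1 (cid (Theta_surj (b g))).
have wP g : Theta (w g) = b g by rewrite /w; case: cid.
have A_lift a : (a <= A)%MS -> edge_lift a =1 grad gen (fun g => dot a (w g)).
  move=> aA [g j]; rewrite /edge_lift /grad /= -dot_delta -dotB.
  apply/esym/subr0_eq; rewrite -dotB; apply: AP => //.
  by rewrite !(ThetaD, ThetaN) Theta_delta theta_q !wP subrr.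
(* A common element has the potentials [dot a (w g)] and [y 0 (q g)], which differ by a constant as
   the Cayley graph is connected. The second is [K]-invariant, so the functional of [a] vanishes on
   every [b x - b 1] with [x] in [K], hence on [V]. *)
have dis : (A :&: D0 = 0)%MS.
  apply/eqP/rowV0P => a; rewrite sub_capmx => /andP[aA /submxP [y ay]].
  have inv g : dot a (w g) - y 0 (q g) = dot a (w 1%g) - y 0 (q 1%g).
    have key : forall g h, dot a (w (h * g)%g) - y 0 (q (h * g)%g) =
                         dot a (w h) - y 0 (q h).
      apply: (generates_ind hgen) => [h|x z IHx IHz h|x IH h|j h].
      - by rewrite mulg1.
      - by rewrite mulgA IHz IHx.
      - by rewrite -(IH (h * x^-1)%g) mulgVK.
      - have := A_lift _ aA (h, j); rewrite {1}ay D0_lift /grad /=.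
        by move: (y 0 _) (y 0 _) (dot a _) (dot a _) => y1 y2 a1 a2; lra.
    by rewrite -(key g 1%g) mul1g.
  have av v : forall u, Theta u = v -> dot a u = 0.
    move: v; apply: (b_span (Q := [set v | forall u, Theta u = v -> dot a u = 0])).
      split=> [|c v1 v2 h1 h2 u hu] /=; first exact: AP.
      have [u1 hu1] := Theta_surj v1.
      have -> : u = c *: u1 + (u - c *: u1) by rewrite addrC subrK.
      rewrite dotP (h1 _ hu1) mulr0 add0r; apply: h2.
      by rewrite ThetaD ThetaN ThetaZ hu hu1 addrAC subrr add0r.
    move=> x xK u hu; have := AP _ aA (u - (w x - w 1%g)).
    rewrite ThetaD ThetaN ThetaD ThetaN hu !wP subrr => /(_ erefl).
    rewrite !dotB; have := inv x; rewrite -{2}[x]mulg1 coset_mull// => /addIr ->.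
    by rewrite subrr subr0.
  apply/rowP => c; rewrite mxE -[c]enum_valK -dot_delta.
  exact: av erefl.
(* The sum has rank [\rank A + \rank D0] and the kernel has rank [k - \rank D0]; inside a space of
   dimension [k] they meet in rank at least [\rank A]. *)
pose W := ((A + D0) :&: kermx D0^T)%MS.
have rW : (n <= \rank W)%N.
  apply: leq_trans nA _.
  have := mxrank_sum_cap (A + D0)%MS (kermx D0^T).
  rewrite (mxrank_disjoint_sum dis) mxrank_ker mxrank_tr -/W.
  have := rank_leq_row (A + D0 + kermx D0^T)%MS; have := rank_leq_col D0.
  lia.
exists (\rank W), (row_base W); split=> //; first exact: row_base_free.
move=> i; have : (row i (row_base W) <= W)%MS.
  by rewrite (submx_trans (row_sub _ _))// eq_row_base.
rewrite sub_capmx => /andP[/sub_addsmxP [[x y] /= ->]].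
move=> /sub_kermxP /D0_ker_divergence dv; split=> //.
have xA : (x *m A <= A)%MS by exact: submxMl.
exists (fun g => dot (x *m A) (w g) + y 0 (q g)) => e.
transitivity (edge_lift (x *m A) e + edge_lift (y *m D0) e).
  by rewrite /edge_lift mxE.
by rewrite (A_lift _ xA) D0_lift /grad addrACA opprD.
Qed.

End CosetEdges.

(** * Chains in the homogeneous bar complex *)

Section Singles.
Variables (R : nzRingType) (S : choiceType).

Lemma singleD x y (s : S) : single (x + y) s = single x s + single y s :> finsupp R S.
Proof.
apply/val_inj/funext => t; rewrite /= !fctE /=.
by case: ifP => //; rewrite addr0.
Qed.

Lemma singleZ a x (s : S) : a *: single x s = single (a * x) s :> finsupp R S.
Proof.
apply/val_inj/funext => t; rewrite /= !fctE /=.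
by case: ifP => //; rewrite scaler0.
Qed.

Lemma singleN x (s : S) : - single x s = single (- x) s :> finsupp R S.
Proof. by rewrite -scaleN1r singleZ mulN1r. Qed.

Definition finsupp_enum (c : finsupp R S) : seq S :=
  finmap.enum_fset (fset_set [set s | val c s != 0]).

Lemma mem_finsupp_enum c s : (s \in finsupp_enum c) = (val c s != 0).
Proof.
rewrite /finsupp_enum in_fset_set; last exact: finsuppP.
by apply/idP/idP; rewrite inE.
Qed.

Lemma finsupp_sum (c : finsupp R S) :
  c = \sum_(s <- finsupp_enum c) single (val c s) s.
Proof.
apply/val_inj/funext => t.
rewrite (big_morph (fun c' : finsupp R S => val c' t : R) (id1 := 0) (op1 := +%R))//=.
have ut : uniq (finsupp_enum c) by exact: finmap.fset_uniq.
have [tc|tc] := boolP (t \in finsupp_enum c).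
  rewrite (bigD1_seq t)//= eqxx big1 ?addr0// => s /negPf st.
  by rewrite eq_sym st.
rewrite big_seq big1 => [|s sc]; last by case: eqP tc => // ->; rewrite sc.
by move: tc; rewrite mem_finsupp_enum negbK => /eqP.
Qed.

End Singles.

Section TensorChains.
Variables (G : groupType) (R : nzRingType) (u : G -> R).

Definition mk_simplex n (l : seq G) : simplex G n := [ffun i => nth 1%g l (val i)].

Lemma sact_simplex n g (l : seq G) : size l = n.+1 ->
  sact g (mk_simplex n l) = mk_simplex n [seq (g * x)%g | x <- l].
Proof.
by move=> sl; apply/ffunP => i; rewrite !ffunE (nth_map 1%g) ?sl // ltn_ord.
Qed.

Lemma edge_simplexE (s : simplex G 1) :
  s = mk_simplex 1 [:: s ord0; s (lift ord0 ord0)].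
Proof.
by apply/ffunP => -[[|[|m]] i] //; rewrite ffunE /=; congr (s _); exact: val_inj.
Qed.

Lemma face_edge (a b : G) : (face ord0 (mk_simplex 1 [:: a; b]) = mk_simplex 0 [:: b]) *
  (face (lift ord0 ord0) (mk_simplex 1 [:: a; b]) = mk_simplex 0 [:: a]).
Proof. by split; apply/ffunP => -[[|m] i] //; rewrite !ffunE. Qed.

Lemma boundary_edge x (a b : G) : boundary (single x (mk_simplex 1 [:: a; b])) =
  single x (mk_simplex 0 [:: b]) - single x (mk_simplex 0 [:: a]) :> finsupp R _.
Proof.
rewrite /boundary !big_ord_recl big_ord0 !push_single !face_edge.
by rewrite expr0 scale1r expr1 scaleN1r addr0.
Qed.

Lemma face_triangle (a b c : G) :
  [/\ face ord0 (mk_simplex 2 [:: a; b; c]) = mk_simplex 1 [:: b; c],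
   face (lift ord0 ord0) (mk_simplex 2 [:: a; b; c]) = mk_simplex 1 [:: a; c] &
   face (lift ord0 (lift ord0 ord0)) (mk_simplex 2 [:: a; b; c]) =
     mk_simplex 1 [:: a; b]].
Proof. by split; apply/ffunP => -[[|[|m]] i] //; rewrite !ffunE. Qed.

Lemma boundary_triangle x (a b c : G) :
  boundary (single x (mk_simplex 2 [:: a; b; c])) =
  single x (mk_simplex 1 [:: b; c]) - single x (mk_simplex 1 [:: a; c]) +
  single x (mk_simplex 1 [:: a; b]) :> finsupp R _.
Proof.
rewrite /boundary !big_ord_recl big_ord0 !push_single.
have [-> -> ->] := face_triangle a b c.
by rewrite expr0 scale1r expr1 scaleN1r sqrrN expr1n scale1r addr0 addrA.
Qed.

Lemma triangle_simplexE (s : simplex G 2) :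
  s = mk_simplex 2 [:: s ord0; s (lift ord0 ord0); s (lift ord0 (lift ord0 ord0))].
Proof.
by apply/ffunP => -[[|[|[|m]]] i] //; rewrite ffunE /=; congr (s _); exact: val_inj.
Qed.

Definition tensor_pi n (c : finsupp R (simplex G n)) : tensor_chain u n :=
  lquot_pi (@tensor_rel G R u n) c.

Lemma tensor_piD n (c d : finsupp R (simplex G n)) :
  tensor_pi (c + d) = tensor_pi c + tensor_pi d.
Proof. exact: lquot_piD. Qed.

Lemma tensor_piZ n a (c : finsupp R (simplex G n)) :
  tensor_pi (a *: c) = a *: tensor_pi c.
Proof. exact: linearZ. Qed.

Lemma tensor_piN n (c : finsupp R (simplex G n)) : tensor_pi (- c) = - tensor_pi c.
Proof. exact: raddfN. Qed.

Lemma tensor_pi_act n x g (s : simplex G n) :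
  tensor_pi (single (x * u g) s) = tensor_pi (single x (sact g s)).
Proof.
apply/eqP/lquot_eqP; apply: sub_lspan; by exists x, g, s.
Qed.

Lemma tensor_boundary_pi n (c : finsupp R (simplex G n.+1)) :
  tensor_boundary u n (tensor_pi c) = tensor_pi (boundary c).
Proof. exact: lquot_map_pi. Qed.

Lemma tensor_chain_sum n (z : tensor_chain u n) :
  exists c : finsupp R (simplex G n), z = tensor_pi c.
Proof. by exists (lquot_repr z); rewrite /tensor_pi lquot_reprK. Qed.

End TensorChains.

(** * The homomorphism from a group to its rational first homology *)

Section RationalH1.
Variable G : groupType.
Local Notation u := (fun _ : G => 1 : rat).
Local Notation V := (H1 u).

Definition loop_chain (g : G) : tensor_chain u 1 :=
  tensor_pi u (single 1 (mk_simplex 1 [:: 1%g; g])).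

Lemma tensor_pi_edge x (a b : G) :
  tensor_pi u (single x (mk_simplex 1 [:: a; b])) = x *: loop_chain (a^-1 * b)%g.
Proof.
rewrite /loop_chain -tensor_piZ singleZ -[in RHS](mulr1 (x * 1)).
rewrite (@tensor_pi_act _ _ u _ (x * 1) a) sact_simplex//= mulr1.
by rewrite mulg1 mulVKg.
Qed.

Fact loop_chain_ker g : loop_chain g \in lker_mem (tensor_boundary u 0).
Proof.
rewrite -topredE /= /lker_mem /loop_chain tensor_boundary_pi boundary_edge.
rewrite tensor_piD tensor_piN.
have := @tensor_pi_act _ _ u 0 1 g (mk_simplex 0 [:: 1%g]).
by rewrite sact_simplex//= mulg1 !mulr1 => ->; rewrite subrr.
Qed.

Definition loop_cycle g : lkernel (tensor_boundary u 0) :=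
  exist (fun z => z \in lker_mem (tensor_boundary u 0)) _ (loop_chain_ker g).

Definition loop_class (g : G) : V := lquot_pi _ (loop_cycle g).

(** The triangle (1, g, gh) bounds the difference, since its edge (g, gh) is equivalent to (1, h)
    after tensoring. *)
Lemma loop_classM g h : loop_class (g * h)%g = loop_class g + loop_class h.
Proof.
rewrite /loop_class -lquot_piD; apply/eqP/lquot_eqP; apply: sub_lspan => /=.
exists (- tensor_pi u (single 1 (mk_simplex 2 [:: 1%g; g; (g * h)%g]))) => //.
rewrite linearN /= tensor_boundary_pi boundary_triangle !tensor_piD tensor_piN.
rewrite tensor_pi_edge scale1r mulKg.
have aux (W : zmodType) (a b c : W) : - (b - c + a) = c - (a + b).
  by rewrite opprD opprB -addrA -opprD [b + a]addrC.
exact: aux.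
Qed.

(** After tensoring, every edge is a multiple of some [loop_chain], which is already a cycle; so
    each cycle is a combination of [loop_cycle]s. *)
Lemma loop_class_span (Q : set V) : is_submod Q ->
  (forall g, Q (loop_class g)) -> forall v, Q v.
Proof.
case=> Q0 QZ Qg v; rewrite -(lquot_reprK v); set y := lquot_repr v.
have [c yc] := tensor_chain_sum (val y).
pose k (s : simplex G 1) := ((s ord0)^-1 * s (lift ord0 ord0))%g.
have -> : y = \sum_(s <- finsupp_enum c) val c s *: loop_cycle (k s).
  apply/val_inj; rewrite yc.
  rewrite (big_morph (fun x => val x : tensor_chain u 1) (id1 := 0) (op1 := +%R))//=.
  rewrite {1}(finsupp_sum c) (big_morph _ (@tensor_piD _ _ u 1) (id1 := 0)).
    by apply: eq_bigr => s _; rewrite /k -tensor_pi_edge -edge_simplexE.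
  exact: raddf0.
apply: (big_ind (fun z => Q (lquot_pi _ z))) => [|a b Qa Qb|s _].
- by rewrite (raddf0 (lquot_pi _)).
- by rewrite lquot_piD -[lquot_pi _ a]scale1r; exact: QZ.
- by rewrite -lquot_scale_pi -[lquot_scale _ _]addr0; apply: QZ => //; exact: Qg.
Qed.

End RationalH1.

Section CosetIndex.
Variables (G : groupType) (K : groupClosed G).
Hypotheses (K_normal : normal_subgroup K) (K_index : finite_index K).

(** [gindex] counts left cosets, whereas [q] must separate right cosets, the orbits of left
    translation by [K]. Normality identifies the two. *)
Lemma coset_index : exists (q : G -> 'I_(gindex K)) (t : 'I_(gindex K) -> G),
  cancel t q /\ forall g h, q g = q h <-> (g * h^-1)%g \in K.
Proof.
pose coset g : set G := [set (g * x)%g | x in [set` K]].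
pose r := finmap.enum_fset (fset_set (lcosets K)).
have rP A : (A \in r) = (A \in lcosets K) by rewrite /r in_fset_set.
have cr g : (index (coset g) r < gindex K)%N.
  by rewrite /gindex index_mem rP inE; exists g.
have cosetP g h : coset g = coset h <-> (g * h^-1)%g \in K.
  split=> [e|gh].
    have : coset h g by rewrite -e; exists 1%g; [exact: gpred1|rewrite mulg1].
    case=> x xK <-; have := K_normal h^-1%g xK.
    by rewrite conjgE invgK mulgA.
  have xK : (h^-1 * g)%g \in K.
    by have := K_normal h gh; rewrite conjgE mulgVK.
  apply/seteqP; split=> [_ [x kx <-]|_ [x kx <-]].
    exists (h^-1 * g * x)%g; first exact: gpredM.
    by rewrite !mulgA mulgV mul1g.
  exists (g^-1 * h * x)%g; last by rewrite !mulgA mulgV mul1g.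
  by apply: gpredM => //; rewrite -gpredV invgM invgK.
have ex (i : 'I_(gindex K)) : exists g, coset g = nth set0 r i.
  have : nth set0 r i \in lcosets K.
    by rewrite -rP mem_nth// ltn_ord.
  by rewrite inE => -[g _ e]; exists g.
exists (fun g => Ordinal (cr g)), (fun i => projT1 (cid (ex i))); split.
  move=> i; apply/val_inj => /=; case: cid => g /= ->.
  by rewrite index_uniq ?finmap.fset_uniq// ltn_ord.
move=> g h; rewrite -cosetP; split=> [[e]|e].
  have gr x : coset x \in r by rewrite rP inE; exists x.
  by rewrite -(nth_index set0 (gr g)) e nth_index.
by apply/val_inj; rewrite /= e.
Qed.

End CosetIndex.

Section FiniteSupportEvaluation.
Variables (R : nzRingType) (S : choiceType) (W : nmodType) (F : S -> R -> W).
Hypothesis F0 : forall s, F s 0 = 0.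
Hypothesis FD : forall s x y, F s (x + y) = F s x + F s y.

(** Additivity in the coefficient suffices; below, the coefficients are operators and each simplex
    supplies the vector to which they are applied. *)
Definition finsupp_eval (c : finsupp R S) : W :=
  \sum_(s <- finsupp_enum c) F s (val c s).

Lemma finsupp_evalE (r : seq S) c : uniq r ->
  (forall s, val c s != 0 -> s \in r) ->
  finsupp_eval c = \sum_(s <- r) F s (val c s).
Proof.
move=> ur cr; rewrite /finsupp_eval [RHS](bigID (fun s => val c s != 0))/=.
rewrite [X in _ = _ + X]big1 ?addr0 => [|s /negPn/eqP ->]//.
rewrite -[RHS]big_filter; apply: perm_big; apply: uniq_perm => [||s].
- exact: finmap.fset_uniq.
- exact: filter_uniq.
- rewrite mem_filter mem_finsupp_enum.
  by apply/idP/andP => [cs|[]//]; split=> //; exact: cr.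
Qed.

Lemma finsupp_eval_single x s : finsupp_eval (single x s) = F s x.
Proof.
rewrite (@finsupp_evalE [:: s])//=; first by rewrite big_seq1 /= eqxx.
by move=> t /=; rewrite inE; case: (t == s) => //; rewrite eqxx.
Qed.

Lemma finsupp_evalD c d : finsupp_eval (c + d) = finsupp_eval c + finsupp_eval d.
Proof.
pose r := undup (finsupp_enum c ++ finsupp_enum d).
have ur : uniq r by exact: undup_uniq.
have cr s : val c s != 0 -> s \in r.
  by move=> cs; rewrite mem_undup mem_cat mem_finsupp_enum cs.
have dr s : val d s != 0 -> s \in r.
  by move=> ds; rewrite mem_undup mem_cat !mem_finsupp_enum ds orbT.
rewrite !(@finsupp_evalE r)// -?big_split => [|s].
  by apply: eq_bigr => s _; exact: FD.
have [cs|/cr//] := eqVneq (val c s) 0.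
by move=> h; apply: dr; apply: contraNneq h => ds; rewrite [val _ s]/= !fctE cs ds addr0.
Qed.

End FiniteSupportEvaluation.

(** * The harmonic projection over the group von Neumann algebra *)

Section EllTwoComponents.
Variables (R : realType) (G : groupType) (d : nat).
Local Notation C := R[i].
Local Notation ell2 := (ell2 R G).
Local Notation edge := (edge G d).
Local Notation L := (l2 R edge).
Implicit Types (x y : ell2) (u w : L).

Lemma sqr_normc (z : C) :
  Normc.normc z ^+ 2 = complex.Re z ^+ 2 + complex.Im z ^+ 2.
Proof. by case: z => a b /=; rewrite sqr_sqrtr// addr_ge0// sqr_ge0. Qed.

Lemma sqnorm_split x : sqnorm (val x) =
  (\esum_(g in [set: G]) (complex.Re (val x g) ^+ 2)%:E +
   \esum_(g in [set: G]) (complex.Im (val x g) ^+ 2)%:E)%E.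
Proof.
rewrite -esumD; try by move=> g _; rewrite lee_fin sqr_ge0.
by apply: eq_esum => g _; rewrite sqr_normc.
Qed.

Lemma esum_fiber (a : G -> \bar R) (j : 'I_d) : (forall g, 0 <= a g)%E ->
  \esum_(e in [set: edge]) (if e.2 == j then a e.1 else 0%E) =
  \esum_(g in [set: G]) a g.
Proof.
move=> a0; transitivity (\esum_(e in [set e : edge | e.2 = j]) a e.1).
  rewrite [RHS]esum_mkcond; apply: eq_esum => e _; congr (if _ then _ else _).
  by apply/eqP/idP; rewrite inE.
rewrite (@reindex_esum _ _ _ [set: G] _ (fun g => (g, j) : edge))//.
split=> [g //|g h _ _ [] //|[g i] /= ->].
by exists g.
Qed.

Definition part (f : C -> R) (j : 'I_d) (x : ell2) : edge -> R^o :=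
  fun e => if e.2 == j then f (val x e.1) else 0.

Lemma esumsq_part f j x :
  esumsq (part f j x) = \esum_(g in [set: G]) (f (val x g) ^+ 2)%:E.
Proof.
rewrite -(@esum_fiber _ j) => [|g]; last by rewrite lee_fin sqr_ge0.
by apply: eq_esum => e _; rewrite /part; case: ifP; rewrite ?expr0n.
Qed.

Fact re_part_mem j x : part (@complex.Re R) j x \in @l2_mem R edge.
Proof.
apply: l2_memP; rewrite esumsq_part; apply: le_lt_trans (ell2P x).
by rewrite sqnorm_split leeDl// esum_ge0// => g _; rewrite lee_fin sqr_ge0.
Qed.

Fact im_part_mem j x : part (@complex.Im R) j x \in @l2_mem R edge.
Proof.
apply: l2_memP; rewrite esumsq_part; apply: le_lt_trans (ell2P x).
by rewrite sqnorm_split leeDr// esum_ge0// => g _; rewrite lee_fin sqr_ge0.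
Qed.

Definition re_part j x : L := mk_l2 (re_part_mem j x).
Definition im_part j x : L := mk_l2 (im_part_mem j x).

Lemma normsq_parts j x :
  (normsq (re_part j x) + normsq (im_part j x))%:E = sqnorm (val x).
Proof. by rewrite EFinD !normsqE !esumsq_part sqnorm_split. Qed.

Definition complexify_fun u w (i : 'I_d) : G -> C^o :=
  fun g => Complex (val u (g, i)) (val w (g, i)).

Lemma sqnorm_complexify u w i :
  (sqnorm (complexify_fun u w i) <= (normsq u + normsq w)%:E)%E.
Proof.
have fiber (z : L) : (\esum_(g in [set: G]) (val z (g, i) ^+ 2)%:E <= esumsq (val z))%E.
  rewrite -(@esum_fiber _ i) => [|g]; last by rewrite lee_fin sqr_ge0.
  apply: le_esum => -[g j] _ /=; case: eqP => [->//|_].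
  by rewrite lee_fin sqr_ge0.
rewrite EFinD !normsqE; apply: le_trans (leeD (fiber u) (fiber w)).
rewrite -esumD; try by move=> g _; rewrite lee_fin sqr_ge0.
by apply: le_esum => g _; rewrite sqr_normc.
Qed.

Fact complexify_mem u w i : complexify_fun u w i \in @ell2_mem R G.
Proof.
by apply/asboolP; apply: (le_lt_trans (sqnorm_complexify u w i)); rewrite ltry.
Qed.

Definition complexify u w i : ell2 :=
  exist (fun x : G -> C^o => x \in @ell2_mem R G) _ (complexify_mem u w i).

Lemma complexifyD u w u' w' i :
  complexify (u + u') (w + w') i = complexify u w i + complexify u' w' i.
Proof. exact/val_inj. Qed.

Lemma complexify0 i : complexify 0 0 i = 0.
Proof. exact/val_inj. Qed.

Lemma complexify_sum (I : Type) (r : seq I) (u w : I -> L) i :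
  \sum_(k <- r) complexify (u k) (w k) i =
  complexify (\sum_(k <- r) u k) (\sum_(k <- r) w k) i.
Proof.
elim: r => [|k r IH]; first by rewrite !big_nil complexify0.
by rewrite !big_cons complexifyD IH.
Qed.

Lemma complexify_decomp u w i :
  complexify u w i = complexify u 0 i + 'i *: complexify w 0 i.
Proof.
apply/val_inj/funext => g; apply/eqP; rewrite eq_complex /=.
by rewrite (_ : (0 : edge -> R^o) (g, i) = 0 :> R)//
  mulr0 !mul0r mul1r subrr addr0 !add0r !eqxx.
Qed.

(** The nesting on the left is the form that [re_partP], [im_partP] and [hproj_linear] produce. *)
Lemma complexifyP (a : C) u w u' w' i :
  complexify (complex.Re a *: u + ((- complex.Im a) *: w + u'))
    (complex.Re a *: w + (complex.Im a *: u + w')) i =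
  a *: complexify u w i + complexify u' w' i.
Proof.
apply/val_inj/funext => g; case: a => a1 a2.
rewrite /= /complexify_fun !(l2_valD, l2_valZ) !fctE /complexify_fun.
apply/eqP; rewrite eq_complex /=.
by rewrite mulNr !addrA !eqxx.
Qed.

Lemma re_partP (a : C) x y j : re_part j (a *: x + y) =
  complex.Re a *: re_part j x + ((- complex.Im a) *: im_part j x + re_part j y).
Proof.
apply/val_inj/funext => e; rewrite !(l2_valD, l2_valZ) /= /part.
case: ifP => _; last by rewrite !mulr0 !addr0.
case: a => a1 a2; rewrite /= !fctE /=; case: (val x _) => x1 x2.
by case: (val y _) => y1 y2 /=; rewrite mulNr addrA.
Qed.

Lemma im_partP (a : C) x y j : im_part j (a *: x + y) =
  complex.Re a *: im_part j x + (complex.Im a *: re_part j x + im_part j y).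
Proof.
apply/val_inj/funext => e; rewrite !(l2_valD, l2_valZ) /= /part.
case: ifP => _; last by rewrite !mulr0 !addr0.
case: a => a1 a2; rewrite /= !fctE /=; case: (val x _) => x1 x2.
by case: (val y _) => y1 y2 /=; rewrite addrA.
Qed.

Lemma sum_re_part_complexify u w : \sum_j re_part j (complexify u w j) = u.
Proof.
apply/val_inj/funext => -[g i].
rewrite (big_morph (fun z : L => val z (g, i) : R) (id1 := 0) (op1 := +%R))//=.
by rewrite (bigD1 i)//= /part /= eqxx big1 ?addr0// => j /negPf ji; rewrite eq_sym ji.
Qed.

Lemma sum_im_part_complexify u w : \sum_j im_part j (complexify u w j) = w.
Proof.
apply/val_inj/funext => -[g i].
rewrite (big_morph (fun z : L => val z (g, i) : R) (id1 := 0) (op1 := +%R))//=.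
by rewrite (bigD1 i)//= /part /= eqxx big1 ?addr0// => j /negPf ji; rewrite eq_sym ji.
Qed.

Lemma re_part_ltrans g j x : re_part j (ltrans g x) = edge_shift g (re_part j x).
Proof. exact/val_inj. Qed.

Lemma im_part_ltrans g j x : im_part j (ltrans g x) = edge_shift g (im_part j x).
Proof. exact/val_inj. Qed.

Lemma complexify_shift g u w i :
  complexify (edge_shift g u) (edge_shift g w) i = ltrans g (complexify u w i).
Proof. exact/val_inj. Qed.

End EllTwoComponents.

Section HarmonicMatrix.
Variables (R : realType) (G : groupType) (d : nat) (gen : 'I_d -> G).
Local Notation C := R[i].
Local Notation ell2 := (ell2 R G).
Local Notation gvN := (gvN R G).
Local Notation edge := (edge G d).
Local Notation L := (l2 R edge).
Local Notation hproj := (hproj (R := R) gen).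

(** The (i, j) entry of the complexified projection: place [x] on the edges labelled [j], project
    real and imaginary parts, and read off the edges labelled [i]. *)
Definition harmonic_op (i j : 'I_d) (x : ell2) : ell2 :=
  complexify (hproj (re_part j x)) (hproj (im_part j x)) i.

Lemma hproj0 : hproj 0 = 0.
Proof. by have := hproj_linear gen (-1) 0 (0 : L); rewrite scaler0 addr0 scaleN1r addNr. Qed.

Lemma hprojD u w : hproj (u + w) = hproj u + hproj w.
Proof. by rewrite -[u]scale1r hproj_linear !scale1r. Qed.

Lemma hproj_sum (I : Type) (r : seq I) (u : I -> L) :
  hproj (\sum_(k <- r) u k) = \sum_(k <- r) hproj (u k).
Proof.
elim: r => [|k r IH]; first by rewrite !big_nil hproj0.
by rewrite !big_cons hprojD IH.
Qed.

Fact harmonic_op_mem i j : harmonic_op i j \in @gvN_mem R G.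
Proof.
apply/asboolP; split=> [a x y||g x].
- rewrite /harmonic_op re_partP im_partP !hproj_linear.
  exact: complexifyP.
- exists 1 => x; rewrite mul1r /ell2_norm ler_wsqrtr//.
  apply: fine_le; try by rewrite ge0_fin_numE ?sqnorm_ge0//; exact: ell2P.
  apply: (le_trans (sqnorm_complexify _ _ _)); rewrite -(normsq_parts j x) lee_fin.
  by apply: lerD; exact: hproj_le.
- by rewrite /harmonic_op re_part_ltrans im_part_ltrans !hproj_shift complexify_shift.
Qed.

Definition harmonic_gvN i j : gvN :=
  exist (fun T : ell2 -> ell2 => T \in @gvN_mem R G) _ (harmonic_op_mem i j).

Definition harmonic_mx : 'M[gvN]_d := \matrix_(i, j) harmonic_gvN i j.

Lemma sum_harmonic_op i u w :
  \sum_j harmonic_op i j (complexify u w j) = complexify (hproj u) (hproj w) i.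
Proof.
pose cu j := complexify u w j.
have -> : \sum_j harmonic_op i j (cu j) =
    complexify (\sum_j hproj (re_part j (cu j))) (\sum_j hproj (im_part j (cu j))) i.
  exact: complexify_sum.
congr (complexify _ _ i).
  by rewrite -(hproj_sum _ (fun j => re_part j (cu j))) sum_re_part_complexify.
by rewrite -(hproj_sum _ (fun j => im_part j (cu j))) sum_im_part_complexify.
Qed.

Lemma gvN_sum_app I (r : seq I) (F : I -> gvN) x :
  val (\sum_(i <- r) F i) x = \sum_(i <- r) val (F i) x.
Proof. by elim: r => [|i r IH]; rewrite ?big_nil ?big_cons -?IH. Qed.

Lemma gvN_lin (T : gvN) a x y : val T (a *: x + y) = a *: val T x + val T y.
Proof. by have [h _ _] := gvNP T; rewrite h. Qed.

Lemma gvN_app0 (T : gvN) : val T 0 = 0.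
Proof. by have := gvN_lin T (-1) 0 0; rewrite scaler0 addr0 scaleN1r addNr. Qed.

Lemma gvN_appD (T : gvN) x y : val T (x + y) = val T x + val T y.
Proof. by rewrite -[x]scale1r gvN_lin !scale1r. Qed.

Lemma gvN_appB (T : gvN) x y : val T (x - y) = val T x - val T y.
Proof. by rewrite -scaleN1r addrC gvN_lin scaleN1r addrC. Qed.

Lemma gvN_app_sum (T : gvN) I (r : seq I) (F : I -> ell2) :
  val T (\sum_(i <- r) F i) = \sum_(i <- r) val T (F i).
Proof.
elim: r => [|i r IH]; first by rewrite !big_nil gvN_app0.
by rewrite !big_cons gvN_appD IH.
Qed.

Lemma mulmx_harmonic_app (v : 'rV[gvN]_d) j x :
  val ((v *m harmonic_mx) 0 j) x = \sum_i val (v 0 i) (harmonic_op i j x).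
Proof. by rewrite mxE gvN_sum_app; apply: eq_bigr => i _; rewrite mxE. Qed.

Lemma harmonic_mx_idem : idempotent_mx harmonic_mx.
Proof.
apply/matrixP => i j; rewrite !mxE; apply/val_inj/funext => x.
rewrite gvN_sum_app; pose u := hproj (re_part j x); pose w := hproj (im_part j x).
transitivity (complexify (hproj u) (hproj w) i); last first.
  by rewrite /u /w (hproj_idem gen (re_part j x)) (hproj_idem gen (im_part j x)).
rewrite -(sum_harmonic_op i u w); apply: eq_bigr => k _.
by rewrite !mxE.
Qed.

Lemma harmonic_mx_trace : complex.Re (\sum_i gvN_trace (harmonic_mx i i)) =
  \sum_i val (hproj (l2_basis R (1%g, i))) (1%g, i).
Proof.
rewrite (big_morph (@complex.Re R) (id1 := 0) (op1 := +%R))//; last first.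
  by move=> [a b] [c e].
apply: eq_bigr => i _; rewrite mxE /gvN_trace /= /harmonic_op /complexify_fun /=.
congr (val (hproj _) _); apply/val_inj/funext => -[g j] /=.
by rewrite /part /= xpair_eqE; case: (j == i); case: (g == 1%g).
Qed.

End HarmonicMatrix.

Section Density.
Variables (R : realType) (G : groupType).
Local Notation ell2 := (ell2 R G).
Local Notation gvN := (gvN R G).
Implicit Types x : ell2.

Lemma sqnorm_eq0 x : sqnorm (val x) = 0%E -> x = 0.
Proof.
move=> x0; apply/val_inj/funext => g; apply: Normc.eq0_normc.
apply/eqP; rewrite -sqrf_eq0 eq_le sqr_ge0 andbT -lee_fin.
apply: (@le_trans _ _ (sqnorm (val x))); last by rewrite x0.
apply: esum_ge; exists [set g]; first by split.
by rewrite fsbig_set1.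
Qed.

Lemma ell2_approx x (e : R) : 0 < e -> exists r : seq G,
  (sqnorm (val (x - \sum_(g <- r) val x g *: ell2_delta R g)%R) <= e%:E)%E.
Proof.
move=> e0; pose a g := ((Normc.normc (val x g)) ^+ 2)%:E.
have a0 g : (0 <= a g)%E by rewrite lee_fin sqr_ge0.
have fx : sqnorm (val x) \is a fin_num.
  by rewrite ge0_fin_numE ?sqnorm_ge0//; exact: ell2P.
have [_ [A [fA _] <-] hA] := @ub_ereal_sup_adherent _ _ e e0 fx.
exists (finmap.enum_fset (fset_set A)).
have AE g : (g \in finmap.enum_fset (fset_set A)) = (g \in A) by rewrite in_fset_set.
set r := finmap.enum_fset _ in AE *; have ur : uniq r by exact: finmap.fset_uniq.
have xr h : val (x - \sum_(g <- r) val x g *: ell2_delta R g) h =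
    if h \in A then 0 else val x h.
  have vs : val (\sum_(g <- r) val x g *: ell2_delta R g) h =
      \sum_(g <- r) val x g * (h == g)%:R.
    by elim: r {ur AE} => [|g r IH]; rewrite ?big_nil// !big_cons -IH.
  rewrite -[LHS]/(val x h - val (\sum_(g <- r) val x g *: ell2_delta R g) h) vs.
  rewrite -AE; case: ifP => hr.
    rewrite (bigD1_seq h)//= eqxx mulr1 big1 ?addr0 ?subrr// => g /negPf gh.
    by rewrite eq_sym gh mulr0.
  rewrite big_seq big1 ?subr0// => g gr; case: eqP => [hg|_]; last by rewrite mulr0.
  by rewrite hg gr in hr.
have sx : sqnorm (val x) = (\sum_(g \in A) a g + \esum_(g in ~` A) a g)%E.
  rewrite /sqnorm (esumID A) => [|g _]; last exact: a0.
  by rewrite !setTI -esum_fset.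
apply: (@le_trans _ _ (\esum_(g in ~` A) a g)%E).
  rewrite /sqnorm esum_mkcond [leRHS]esum_mkcond; apply: le_esum => g _.
  rewrite xr in_setT in_setC; case: (g \in A) => //.
  by rewrite Normc.normc0 expr0n.
have fs : (\sum_(g \in A) a g)%E \is a fin_num.
  by rewrite fsumEFin.
have {hA} : (sqnorm (val x) - e%:E < \sum_(g \in A) a g)%E by exact: hA.
rewrite sx lteBlDr//.
move: (\esum_(g in ~` A) a g)%E => t; rewrite -(fineK fs).
case: t => [t||]//=; rewrite -?EFinD ?lte_fin ?lee_fin ?leNye//.
by move=> h; lra.
Qed.

(** Equivariance carries the vanishing to all basis vectors, and boundedness from their dense span
    to the whole space. *)
Lemma gvN_eq0 (T : gvN) : val T (ell2_delta R 1%g) = 0 -> T = 0.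
Proof.
have [Tl [M TM] Tc] := gvNP T => T1.
have Td g : val T (ell2_delta R g) = 0.
  have -> : ell2_delta R g = ltrans g (ell2_delta R 1%g).
    apply/val_inj/funext => h /=; congr (_%:R).
    by rewrite eq_sym -(inj_eq (@mulgI _ g^-1%g)) mulVg eq_sym.
  by rewrite Tc T1 ltrans0.
apply/val_inj/funext => x; apply: sqnorm_eq0; apply/eqP.
rewrite eq_le sqnorm_ge0 andbT; apply/lee_addgt0Pr => e e0; rewrite add0e.
have M0 : 0 < M ^+ 2 + 1 by rewrite ltr_wpDl// sqr_ge0.
have [r hr] := ell2_approx x (divr_gt0 e0 M0).
set y := x - _ in hr.
have TE : val T x = val T y.
  rewrite /y gvN_appD -scaleN1r -[X in val T (-1 *: X)]addr0 -[-1 *: _]addr0 gvN_lin.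
  rewrite gvN_app0 addr0 addr0 gvN_app_sum big1 ?scaler0 ?addr0// => g _.
  by rewrite -[_ *: _]addr0 gvN_lin Td gvN_app0 scaler0 addr0.
have fin (z : ell2) : sqnorm (val z) \is a fin_num.
  by rewrite ge0_fin_numE ?sqnorm_ge0//; exact: ell2P.
have nE (z : ell2) : (ell2_norm z ^+ 2)%:E = sqnorm (val z).
  by rewrite sqr_sqrtr ?fine_ge0 ?sqnorm_ge0// fineK.
rewrite TE -nE; move: hr; rewrite -nE !lee_fin => hr.
have n0 (z : ell2) : 0 <= ell2_norm z by exact: sqrtr_ge0.
apply: (@le_trans _ _ ((M * ell2_norm y) ^+ 2)).
  by rewrite ler_pXn2r// ?nnegrE// (le_trans (n0 _) (TM y)).
rewrite exprMn; apply: (@le_trans _ _ (M ^+ 2 * (e / (M ^+ 2 + 1)))).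
  by rewrite ler_wpM2l// sqr_ge0.
rewrite mulrCA -[leRHS]mulr1 ler_pM2l// ler_pdivrMr// mul1r.
by rewrite lerDl.
Qed.

End Density.

(** * Embedding the image of the harmonic matrix into homology *)

Section HarmonicClasses.
Variables (R : realType) (G : groupType) (d : nat) (gen : 'I_d -> G).
Hypothesis hgen : generates gen.
Local Notation ell2 := (ell2 R G).
Local Notation gvN := (gvN R G).
Local Notation edge := (edge G d).
Local Notation L := (l2 R edge).
Local Notation hproj := (hproj (R := R) gen).
Local Notation A := (harmonic_mx R gen).
Local Notation rho := (@gvN_of R G).

Definition row_app (v : 'rV[gvN]_d) (u : L) : ell2 :=
  \sum_i val (v 0 i) (complexify u 0 i).

Lemma row_app_harmonic v u : row_app (v *m A) u = row_app v (hproj u).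
Proof.
pose cu j := complexify u 0 j.
transitivity (\sum_j \sum_i val (v 0 i) (harmonic_op gen i j (cu j))).
  by apply: eq_bigr => j _; rewrite mulmx_harmonic_app.
rewrite exchange_big; apply: eq_bigr => i _ /=.
by rewrite -gvN_app_sum sum_harmonic_op hproj0.
Qed.

Lemma harmonic_row_app (v : 'rV[gvN]_d) j x : val ((v *m A) 0 j) x =
  row_app v (hproj (re_part j x)) + 'i *: row_app v (hproj (im_part j x)).
Proof.
rewrite mulmx_harmonic_app /row_app scaler_sumr -big_split.
apply: eq_bigr => i _; rewrite /harmonic_op complexify_decomp addrC gvN_lin.
by rewrite addrC.
Qed.

Definition unit_coboundary : seq (R * edge) :=
  [seq (1, ((gen i)^-1%g, i)) | i <- index_enum 'I_d] ++
  [seq (-1, (1%g, i)) | i <- index_enum 'I_d].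

Lemma unit_coboundaryE (F : edge -> R) : chain_pair unit_coboundary F =
  \sum_i (F ((gen i)^-1%g, i) - F (1%g, i)).
Proof.
rewrite chain_pair_cat /chain_pair !big_map -big_split; apply: eq_bigr => i _ /=.
by rewrite mul1r mulN1r.
Qed.

Lemma unit_coboundary_kills : kills_harmonic gen unit_coboundary.
Proof.
move=> F [_ /(_ 1%g) dF]; rewrite unit_coboundaryE -[RHS]dF.
by apply: eq_bigr => i _; rewrite mul1g.
Qed.

Lemma complexify_coboundary i : complexify (chain_l2 unit_coboundary) 0 i =
  rtrans (gen i) (ell2_delta R 1%g) - ell2_delta R 1%g.
Proof.
apply/val_inj/funext => g.
rewrite -[RHS]/((g * gen i == 1)%g%:R - (g == 1%g)%:R : R[i]).
rewrite -[LHS]/(Complex (val (chain_l2 unit_coboundary) (g, i)) 0).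
rewrite -ip2_basis ip2C ip2_chain unit_coboundaryE (bigD1 i)//= big1 => [|k ki].
  rewrite !xpair_eqE !eqxx !andbT addr0.
  have -> : ((gen i)^-1%g == g) = (g * gen i == 1)%g by rewrite mulg_eq1 eq_sym.
  rewrite [(1%g == g)]eq_sym; apply/eqP; rewrite eq_complex.
  by case: (g * gen i == 1)%g; case: (g == 1%g);
    rewrite /= ?(subr0, oppr0, addr0, subrr) ?eqxx.
by rewrite !xpair_eqE (negPf ki) !andbF subrr.
Qed.

(** By [gvN_eq0] it is enough to evaluate at the basis vector of 1. There the sum becomes [v *m A]
    applied to the coboundary of the unit vertex, which the projection kills. *)
Lemma harmonic_row_cycle (v : 'rV[gvN]_d) :
  \sum_i ((v *m A) 0 i * rho (gen i) - (v *m A) 0 i) = 0.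
Proof.
apply: gvN_eq0; rewrite gvN_sum_app.
transitivity (row_app (v *m A) (chain_l2 unit_coboundary)).
  by apply: eq_bigr => i _; rewrite complexify_coboundary gvN_appB.
rewrite row_app_harmonic (hproj_kills unit_coboundary_kills).
by rewrite /row_app big1// => i _; rewrite complexify0 gvN_app0.
Qed.

Definition edge_simplex (j : 'I_d) : simplex G 1 := mk_simplex 1 [:: 1%g; gen j].

Definition row_finsupp (v : 'rV[gvN]_d) : finsupp gvN (simplex G 1) :=
  \sum_j single (v 0 j) (edge_simplex j).

Definition row_chain (v : 'rV[gvN]_d) : tensor_chain rho 1 :=
  tensor_pi rho (row_finsupp v).

Lemma row_finsupp_linear : linear row_finsupp.
Proof.
move=> a v w; rewrite /row_finsupp scaler_sumr -big_split; apply: eq_bigr => j _ /=.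
by rewrite !mxE singleD singleZ.
Qed.

Lemma row_chain_linear : linear row_chain.
Proof. by move=> a v w; rewrite /row_chain row_finsupp_linear tensor_piD tensor_piZ. Qed.

Lemma tensor_pi_sum n I (r : seq I) (F : I -> finsupp gvN (simplex G n)) :
  tensor_pi rho (\sum_(i <- r) F i) = \sum_(i <- r) tensor_pi rho (F i).
Proof.
elim: r => [|i r IH]; first by rewrite !big_nil; exact: raddf0.
by rewrite !big_cons tensor_piD IH.
Qed.

Lemma boundary_row_chain v : tensor_boundary rho 0 (row_chain v) =
  tensor_pi rho (single (\sum_i (v 0 i * rho (gen i) - v 0 i)) (mk_simplex 0 [:: 1%g])).
Proof.
rewrite /row_chain tensor_boundary_pi /row_finsupp linear_sum tensor_pi_sum.
transitivity (\sum_i tensor_pi rho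
    (single (v 0 i * rho (gen i) - v 0 i) (mk_simplex 0 [:: 1%g]))).
  apply: eq_bigr => i _; rewrite /= boundary_edge singleD -singleN.
  rewrite !tensor_piD tensor_pi_act sact_simplex//=.
  by rewrite mulg1.
rewrite -tensor_pi_sum; congr tensor_pi.
elim: (index_enum _) => [|i r IH]; last by rewrite !big_cons IH -singleD.
rewrite !big_nil; apply/val_inj/funext => s /=.
by case: ifP.
Qed.

Fact harmonic_chain_ker (v : 'rV[gvN]_d) :
  row_chain (v *m A) \in lker_mem (tensor_boundary rho 0).
Proof.
rewrite -topredE /= /lker_mem boundary_row_chain harmonic_row_cycle.
rewrite (_ : single 0 _ = 0); first by rewrite /tensor_pi raddf0.
by apply/val_inj/funext => s /=; case: ifP.
Qed.

Definition harmonic_cycle (v : 'rV[gvN]_d) : lkernel (tensor_boundary rho 0) :=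
  exist (fun z => z \in lker_mem (tensor_boundary rho 0)) _ (harmonic_chain_ker v).

Definition harmonic_class (v : 'rV[gvN]_d) : H1 rho := lquot_pi _ (harmonic_cycle v).

Lemma harmonic_class_linear : linear harmonic_class.
Proof.
move=> a v w; rewrite /harmonic_class.
have -> : harmonic_cycle (a *: v + w) = a *: harmonic_cycle v + harmonic_cycle w.
  by apply/val_inj; rewrite /= mulmxDl -scalemxAl row_chain_linear.
exact: lquot_pi_is_linear.
Qed.

(* A harmonic l2-form u is the gradient of some f, and g |-> f(. g) - f is a
   1-cocycle with values in l2. *)
Lemma harmonic_cocycle u : exists f (D : G -> ell2),
  (forall g h, val (D g) h = Complex (f (h * g)%g - f h) 0) /\
  (forall j, D (gen j) = complexify (hproj u) 0 j).
Proof.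
have [f Ff] := hproj_grad hgen u.
have ex g : exists y : ell2, forall h, val y h = Complex (f (h * g)%g - f h) 0.
  move: g; apply: (generates_ind hgen) => [|x z [y1 h1] [y2 h2]|x [y hy]|j].
  - by exists 0 => h; rewrite mulg1 subrr.
  - exists (rtrans x y2 + y1) => h; rewrite -[LHS]/(val y2 (h * x)%g + val y1 h) h1 h2.
    by apply/eqP; rewrite eq_complex /= addr0 eqxx andbT mulgA addrA subrK.
  - exists (- rtrans x^-1%g y) => h; rewrite -[LHS]/(- val y (h * x^-1)%g) hy mulgVK.
    by apply/eqP; rewrite eq_complex /= oppr0 opprB !eqxx.
  - by exists (complexify (hproj u) 0 j) => h; rewrite /= /complexify_fun Ff.
exists f, (fun g => projT1 (cid (ex g))).
have DP g : forall h, val (projT1 (cid (ex g))) h = Complex (f (h * g)%g - f h) 0.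
  by case: cid.
split=> // j; apply/val_inj/funext => h; rewrite DP /= /complexify_fun.
by rewrite Ff.
Qed.

(** Evaluating an edge (a, b) with coefficient [T] as [T (D b - D a)], with [D] from
    [harmonic_cocycle], kills boundaries of triangles by telescoping and the tensor relations by the
    cocycle property. On [row_finsupp v] it gives [row_app v (hproj u)]. *)
Lemma row_app_boundary (v : 'rV[gvN]_d) (c : finsupp gvN (simplex G 2)) u :
  lspan (@tensor_rel G gvN rho 1) (row_finsupp v - boundary c) ->
  row_app v (hproj u) = 0.
Proof.
have [f [D [DP Dgen]]] := harmonic_cocycle u.
pose F (s : simplex G 1) (T : gvN) : ell2 := val T (D (s (lift ord0 ord0)) - D (s ord0)).
have F0 s : F s 0 = 0 by [].
have FD s x y : F s (x + y) = F s x + F s y by [].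
pose ev := finsupp_eval F.
have evD : {morph ev : x y / x + y} by move=> x y; exact: finsupp_evalD.
have ev1 x s : ev (single x s) = F s x by exact: finsupp_eval_single.
have ev0 : ev 0 = 0.
  have -> : (0 : finsupp gvN (simplex G 1)) = single 0 (mk_simplex 1 [::]).
    by apply/val_inj/funext => s /=; case: ifP.
  by rewrite ev1.
have evN x : ev (- x) = - ev x by apply/eqP; rewrite -addr_eq0 -evD addNr ev0.
have ev_sum I (r : seq I) (E : I -> finsupp gvN (simplex G 1)) :
    ev (\sum_(i <- r) E i) = \sum_(i <- r) ev (E i) by exact: (big_morph _ evD ev0).
have evZ (T : gvN) x : ev (T *: x) = val T (ev x).
  rewrite (finsupp_sum x) scaler_sumr !ev_sum gvN_app_sum.
  by apply: eq_bigr => s _; rewrite singleZ !ev1.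
have D1 : D 1%g = 0.
  by apply/val_inj/funext => h; rewrite DP mulg1 subrr.
have evb : ev (boundary c) = 0.
  rewrite (finsupp_sum c) linear_sum ev_sum big1// => s _ /=.
  rewrite (triangle_simplexE s); move: (s _) (s _) (s _) => a b e.
  rewrite boundary_triangle !evD evN !ev1 /F /= !ffunE /=.
  rewrite -gvN_appB -gvN_appD (_ : _ + _ = 0) ?gvN_app0//.
  have aux (W : zmodType) (x y z : W) : x - y - (x - z) + (y - z) = 0.
    by rewrite opprB [x - y + _]addrC subrKA subrKA subrr.
  exact: aux.
have evrel y : lspan (@tensor_rel G gvN rho 1) y -> ev y = 0.
  apply: (@lspan_min _ _ _ [set y | ev y = 0]).
    split=> [|T x z /= ex ez]; first exact: ev0.
    by rewrite evD evZ ex ez gvN_app0 addr0.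
  move=> _ [T [g [s ->]]] /=; rewrite evD evN !ev1 /F.
  apply/eqP; rewrite subr_eq0; apply/eqP; congr (val T _).
  (* The base values f(hg) and f(h) cancel on their respective sides, and both differences are
     f(hgb) - f(hga) for the edge (a, b). *)
  apply/val_inj/funext => h; rewrite !ffunE.
  rewrite -[LHS]/(val (D _) (h * g)%g - val (D _) (h * g)%g).
  rewrite -[RHS]/(val (D _) h - val (D _) h) !DP.
  apply/eqP; rewrite eq_complex /= subrr eqxx andbT !mulgA.
  by rewrite !opprB !addrA !subrK.
move=> /evrel; rewrite evD evN evb oppr0 addr0 /row_finsupp ev_sum => <-.
apply: eq_bigr => j _; rewrite ev1 /F !ffunE /= D1 subr0 Dgen.
by [].
Qed.

Lemma harmonic_class_eq0 (v : 'rV[gvN]_d) : harmonic_class v = 0 -> v *m A = 0.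
Proof.
move=> v0; have : harmonic_class v == lquot_pi _ 0 by rewrite v0 (raddf0 (lquot_pi _)).
move=> /lquot_eqP; rewrite subr0 => hz.
have [w /= hw] : range (tensor_boundary rho 1) (row_chain (v *m A)).
  move: hz; apply: (@lspan_min _ _ _ [set z | range (tensor_boundary rho 1) (val z)]) => //.
  split=> [|a x y /= [x' _ hx] [y' _ hy]]; first by exists 0 => //; rewrite linear0.
  by exists (a *: x' + y') => //; rewrite [LHS]linearP; congr (_ *: _ + _).
have [c wc] := tensor_chain_sum w.
move=> /eqP; rewrite wc tensor_boundary_pi eq_sym => /lquot_eqP hc.
have key u := row_app_boundary u hc.
(* [key] controls a row only on projected forms; the extra factor [A] brings the arguments into that
   form. *)
have vE : v *m A = v *m A *m A by rewrite -mulmxA harmonic_mx_idem.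
apply/rowP => j; rewrite vE [RHS]mxE; apply/val_inj/funext => x.
rewrite -[LHS]/(val ((v *m A *m A) 0 j) x) harmonic_row_app !key.
by rewrite scaler0 addr0.
Qed.

Lemma b1_l2_ge_trace :
  ((\sum_i val (hproj (l2_basis R (1%g, i))) (1%g, i))%:E <= b1_l2 R G)%E.
Proof.
pose f : {linear 'rV[gvN]_d -> H1 rho} :=
  HB.pack harmonic_class (GRing.isLinear.Build _ _ _ _ _ harmonic_class_linear).
apply: ereal_sup_ubound.
exists (f @` range (mulmx^~ A)), d, A; split; last by rewrite harmonic_mx_trace.
  exact: harmonic_mx_idem.
exists f; split=> // x y; rewrite !inE => -[x' _ <-] [y' _ <-] fxy.
apply/eqP; rewrite -subr_eq0 -mulmxBl.
have <- : (x' - y') *m A *m A = (x' - y') *m A by rewrite -mulmxA harmonic_mx_idem.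
apply/eqP/harmonic_class_eq0; rewrite mulmxBl.
have fxy' : harmonic_class (x' *m A) = harmonic_class (y' *m A) by exact: fxy.
by rewrite -scaleN1r addrC harmonic_class_linear scaleN1r fxy' addNr.
Qed.

End HarmonicClasses.

(** * Approximation *)

Section SubgroupLoops.
Variables (G : groupType) (K : groupClosed G) (m : nat).
Variables (q : G -> 'I_m) (t : 'I_m -> G).
Hypothesis tK : cancel t q.
Hypothesis qP : forall g h, q g = q h <-> (g * h^-1)%g \in K.
Local Notation V := (H1 (fun _ : subgroup_of K => 1 : rat)).

(** This is the map [b] of the coset graph. The element lies in [K], so the default of [insubd]
    never occurs; the value at 1 can be nonzero, because the representative of [K] need not be 1. *)
Definition coset_loop (g : G) : V :=
  loop_class (insubd (1%g : subgroup_of K) (g * (t (q g))^-1)%g).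

Lemma coset_loopE x g : x \in K ->
  coset_loop (x * g)%g = loop_class (insubd (1%g : subgroup_of K) x) + coset_loop g.
Proof.
move=> xK; rewrite /coset_loop -loop_classM; congr loop_class; apply/val_inj.
have gK := coset_repr_mem tK qP g.
have xgK : (x * g * (t (q (x * g)%g))^-1)%g \in K by exact: (coset_repr_mem tK qP).
rewrite val_insubd xgK valM !val_insubd xK gK.
by rewrite (coset_mull qP g xK) mulgA.
Qed.

Lemma coset_loopM x g : x \in K ->
  coset_loop (x * g)%g = coset_loop x - coset_loop 1%g + coset_loop g.
Proof.
move=> xK; rewrite coset_loopE//; congr (_ + _).
by rewrite -[X in coset_loop X - _]mulg1 (coset_loopE _ xK) addrK.
Qed.

Lemma coset_loop_span (Q : set V) : is_submod Q ->
  (forall x, x \in K -> Q (coset_loop x - coset_loop 1%g)) -> forall v, Q v.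
Proof.
move=> sQ hQ; apply: loop_class_span => // g.
have := hQ _ (valP g); rewrite -[X in coset_loop X - _]mulg1 (coset_loopE _ (valP g)).
by rewrite addrK valKd.
Qed.

End SubgroupLoops.

Section FiniteLevel.
Variables (R : realType) (G : groupType) (d : nat) (gen : 'I_d -> G).
Hypothesis hgen : generates gen.
Variable K : groupClosed G.
Hypotheses (K_normal : normal_subgroup K) (K_index : finite_index K).
Local Notation edge := (edge G d).

Lemma harmonic_form_ratr (F : edge -> rat) : harmonic_form gen F ->
  harmonic_form gen (fun x => ratr (F x) : R).
Proof.
case=> -[f Ff] dF; split.
  by exists (fun g => ratr (f g)) => x; rewrite Ff /grad rmorphB.
move=> h; rewrite -[RHS](rmorph0 (ratr : rat -> R)) -(dF h) rmorph_sum.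
by apply: eq_bigr => j _; rewrite rmorphB.
Qed.

Definition residual_chain (c : 'I_d -> seq (R * edge)) j : seq (R * edge) :=
  (1, (1%g, j)) :: chain_scale (-1) (c j).

Lemma chain_l2_residual c j : chain_l2 (residual_chain c j) =
  l2_basis R (1%g, j) - chain_l2 (c j).
Proof. by rewrite /chain_l2 big_cons -!/(chain_l2 _) chain_l2_scale scale1r scaleN1r. Qed.

Lemma dim_le_residual (c : 'I_d -> seq (R * edge)) n
  (f : {linear 'rV[rat]_n -> H1 (fun _ : subgroup_of K => 1 : rat)}) :
  (forall j, kills_harmonic gen (c j)) ->
  (forall j x y, x \in residual_chain c j -> y \in residual_chain c j ->
     (x.2.1 * y.2.1^-1)%g \in K -> x.2.1 = y.2.1) ->
  injective f ->
  n%:R <= (gindex K)%:R * \sum_j normsq (l2_basis R (1%g, j) - chain_l2 (c j)).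
Proof.
move=> ck csep finj.
have [q [t [tK qP]]] := coset_index K_normal K_index.
have [r [H [nr Hfree Hharm]]] := harmonic_edges hgen tK qP
  (coset_loopM tK qP) (@coset_loop_span _ _ _ _ _ tK qP) finj.
pose E := ('I_(gindex K) * 'I_d)%type.
pose w (e : E) := chain_map (eact (t e.1)) (residual_chain c e.2).
pose rk (x : edge) := enum_rank ((q x.1, x.2) : E).
(* Row [a] of [D] is the image in the coset graph of the residual chain translated to the edge
   [a]. *)
pose D : 'M[R]_#|{: E}| :=
  \matrix_(a, b) chain_pair (w (enum_val a)) (fun x => (rk x == b)%:R).
have sumD (h : 'I_#|{: E}| -> R) a :
    \sum_b D a b * h b = chain_pair (w (enum_val a)) (h \o rk).
  under eq_bigr do rewrite mxE /chain_pair mulr_suml.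
  rewrite exchange_big; apply: eq_bigr => p _ /=.
  rewrite (bigD1 (rk p.2))//= eqxx mulr1 big1 ?addr0// => b /negPf nb.
  by rewrite eq_sym nb mulr0 mul0r.
pose HR := map_mx (ratr : rat -> R) H.
have HRfree : row_free HR by rewrite /row_free mxrank_map.
(* A translated residual is its edge minus a chain that kills harmonic forms, so pairing it with a
   harmonic form returns the value at the edge. *)
have DH : D *m HR^T = HR^T.
  apply/matrixP => a i; rewrite mxE; under eq_bigr do rewrite [HR^T _ _]mxE.
  rewrite (sumD (HR i)) [RHS]mxE.
  have hF : harmonic_form gen (HR i \o rk).
    have := harmonic_form_ratr (Hharm i); congr harmonic_form.
    by apply/funext => x; rewrite /= /edge_lift !mxE.
  rewrite /w chain_pair_map chain_pair_cons chain_pair_scale.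
  have hF' := harmonic_form_act (t (enum_val a).1) hF.
  rewrite (ck _ _ hF') mulr0 addr0 mul1r /= /eact /rk /= mulg1 tK.
  by rewrite -surjective_pairing enum_valK.
apply: (@le_trans _ _ r%:R); first by rewrite ler_nat.
apply: le_trans (dim_le_sqnorm HRfree DH) _.
(* By the separation hypothesis distinct edges of a residual chain stay distinct in the coset graph,
   so its norm is preserved. *)
have rowD a : \sum_b D a b ^+ 2 =
    normsq (l2_basis R (1%g, (enum_val a).2) - chain_l2 (c (enum_val a).2)).
  have -> : \sum_b D a b ^+ 2 = \sum_b D a b * D a b by [].
  rewrite (sumD (D a)) -chain_l2_residual -ip2xx ip2_chain2.
  rewrite /w /chain_pair big_map big_seq [RHS]big_seq; apply: eq_bigr => x xc /=.
  rewrite mxE /chain_pair /w big_map mulr_sumr big_seq [RHS]big_seq.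
  apply: eq_bigr => y yc /=; rewrite mulrA; congr (_ * (nat_of_bool _)%:R).
  rewrite /rk (inj_eq enum_rank_inj) /=.
  apply/eqP/eqP => [[/qP]|->//].
  set s := t _ => sK e2; rewrite [RHS]surjective_pairing [LHS]surjective_pairing.
  congr pair => //.
  apply/esym; apply: (csep _ _ _ yc xc).
  (* Conjugation by [s] removes the translation from the membership in [K]. *)
  by have := K_normal s sK; rewrite conjgE invgM !mulgA mulVg mul1g mulgVK.
under eq_bigr do rewrite rowD.
rewrite sum_enum_rank; under eq_bigr do rewrite enum_rankK.
rewrite -(pair_bigA _ (fun _ j => normsq (l2_basis R (1%g, j) - chain_l2 (c j))))/=.
by rewrite sumr_const card_ord mulr_natl.
Qed.

End FiniteLevel.

Lemma limn_esup_le (R : realType) (u : nat -> \bar R) (a : \bar R) (N : nat) :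
  (forall n, (N <= n)%N -> (u n <= a)%E) -> (limn_esup u <= a)%E.
Proof.
move=> h; apply: ge_ereal_inf; exists (ereal_sup (u @` [set n | (N <= n)%N])).
  by exists [set n | (N <= n)%N] => //; exists N.
by apply: ub_ereal_sup => _ [n /= Nn <-]; exact: h.
Qed.

Lemma decreasing_subgroups_avoid (G : groupType) (N : nat -> groupClosed G) (s : seq G) :
  (forall i, {subset N i.+1 <= N i}) ->
  \bigcap_(i in [set: nat]) [set` N i] = [set 1%g] ->
  exists i0, forall i, (i0 <= i)%N -> forall x, x \in s -> x \in N i -> x = 1%g.
Proof.
move=> Ndec Ncap.
have Nle i j : (i <= j)%N -> {subset N j <= N i}.
  move=> /subnK <-; elim: (j - i)%N => [//|n IH] x; rewrite addSn => /Ndec.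
  exact: IH.
elim: s => [|y s [i0 h0]]; first by exists 0%N.
have [i1 h1] : exists i1, y \in N i1 -> y = 1%g.
  apply: contrapT => /forallNP h; have : [set 1%g] y.
    rewrite -Ncap => i _ /=; apply: contrapT => yN.
    by apply: (h i).
  by move=> y1; apply: (h 0%N).
exists (maxn i0 i1) => i; rewrite geq_max => /andP[i0i i1i] x.
rewrite inE => /predU1P[->|xs]; last exact: h0.
by move=> /(Nle _ _ i1i); exact: h1.
Qed.

Theorem theorem1p1 (R : realType) (G : groupType) (N : nat -> groupClosed G) :
  finitely_generated G ->
  residually_finite G ->
  (forall i, normal_subgroup (N i)) ->
  (forall i, finite_index (N i)) ->
  (forall i, {subset N i.+1 <= N i}) ->
  \bigcap_(i in [set: nat]) [set` N i] = [set 1%g] ->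
  (limn_esup (fun i => b1 R (subgroup_of (N i)) * ((gindex (N i))%:R^-1)%:E)
     <= b1_l2 R G)%E.
Proof.
move=> /finitely_generatedP [d [gen hgen]] _ Nnormal Nindex Ndec Ncap.
apply: le_trans (b1_l2_ge_trace R hgen).
set tr := \sum_i _; apply/lee_addgt0Pr => e e0; rewrite -EFinD.
(* Dividing by [d.+1] rather than [d] also covers the empty generating family. *)
have ed : 0 < e / d.+1%:R by rewrite divr_gt0.
pose c j := projT1 (cid (hproj_approx gen (1%g, j) ed)).
have cP j : kills_harmonic gen (c j) /\ normsq (l2_basis R (1%g, j) - chain_l2 (c j)) <=
    val (hproj gen (l2_basis R (1%g, j))) (1%g, j) + e / d.+1%:R.
  by rewrite /c; case: cid.
have tr_le : \sum_j normsq (l2_basis R (1%g, j) - chain_l2 (c j)) <= tr + e.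
  apply: (@le_trans _ _ (tr + \sum_(j < d) e / d.+1%:R)).
    by rewrite -big_split; apply: ler_sum => j _; case: (cP j).
  rewrite lerD2l sumr_const card_ord -mulrnAr -[leRHS]mulr1 ler_pM2l//.
  by rewrite -mulr_natl ler_pdivrMr// mul1r ler_nat.
(* Once [N i] contains no nontrivial element of this finite list, it separates the vertices of every
   residual chain. *)
pose diffs : seq G := flatten [seq [seq (x.2.1 * y.2.1^-1)%g |
  x <- residual_chain c j, y <- residual_chain c j] | j <- index_enum 'I_d].
have [i0 hi0] := decreasing_subgroups_avoid diffs Ndec Ncap.
apply: (@limn_esup_le _ _ _ i0) => i i0i.
have [q _] := coset_index (Nnormal i) (Nindex i).
have m0 : (0 < gindex (N i))%N by apply: leq_ltn_trans (ltn_ord (q 1%g)).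
rewrite lee_pdivrMr ?ltr0n// -EFinM.
apply: ub_ereal_sup => _ [n [f finj] <-]; rewrite lee_fin mulrC.
apply: le_trans (dim_le_residual hgen (Nnormal i) (Nindex i) (c := c) _ _ finj) _.
- by move=> j; case: (cP j).
- move=> j x y xc yc /(hi0 _ i0i) h; apply/eqP; rewrite -divg_eq1; apply/eqP/h.
  apply/flattenP; exists [seq (x.2.1 * y.2.1^-1)%g |
    x <- residual_chain c j, y <- residual_chain c j].
    by apply/mapP; exists j => //; rewrite mem_index_enum.
  by apply/allpairsP; exists (x, y).
- by rewrite ler_wpM2l.
Qed.
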